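(* Let $G\rightrightarrows M$ be a bisectional continuous groupoid. Then there is a bijective correspondence between (a) continuous unitary representations of $G$, and (b) continuous $C_0(M)$-unitary representations $\tilde\pi$ of $\mathrm{Bis}(G)$ on a Hilbert $C_0(M)$-module $\Delta$ satisfying - $C_0(M)$-linearity, i.e. $\tilde\pi(\sigma)(f\,\xi)=\tilde\sigma^*f\,\tilde\pi(\sigma)(\xi)$ for all $\sigma\in\mathrm{Bis}(G)$, $\xi\in\Delta$ and $f\in C_0(M)$; and - locality, i.e. if $\sigma(m)=1_m$ for some $m\in M$, then $\|\tilde\pi(\sigma)\xi-\xi\|(m)=0$ (for $\xi\in\Delta$).
   Context: $M$ is a locally compact Hausdorff space and $G\rightrightarrows M$ is a continuous (topological) groupoid with source $s$, target $t$, units $1_m$; $gg'$ is defined when $s(g)=t(g')$. Continuous field of Hilbert spaces over $M$: a pair $(\mathcal H,\Delta)$, with Hilbert spaces $\{\mathcal H_m\}_{m\in M}$ and a linear space of sections $\Delta\subset\prod_m\mathcal H_m$ such that (i) $\{\xi(m):\xi\in\Delta\}=\mathcal H_m$ for all $m$; (ii) $m\mapsto\|\xi(m)\|$ is in $C_0(M)$ for all $\xi\in\Delta$; (iii) if $\xi\in\prod_m\mathcal H_m$ and for each $\varepsilon>0$ and $m\in M$ there is $\eta\in\Delta$ with $\|\xi(n)-\eta(n)\|<\varepsilon$ for $n$ in a neighborhood of $m$, then $\xi\in\Delta$. The total space $\mathcal H=\coprod_m\mathcal H_m$, with projection $p:\mathcal H\to M$, has the topology with basis $U(\varepsilon,\xi,V)=\{h: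 p(h)\in V,\ \|h-\xi(p(h))\|<\varepsilon\}$ ($\varepsilon>0$, $\xi\in\Delta$, $V\subset M$ open). A Hilbert $C_0(M)$-module is a Banach space $\Delta$ with a $C_0(M)$-module structure and a $C_0(M)$-valued inner product $\langle\cdot,\cdot\rangle$ (sesquilinear, $C_0(M)$-linear in the second variable, Hermitian, positive definite) whose norm is $\|\xi\|_\Delta=\sqrt{\|\langle\xi,\xi\rangle\|_{C_0(M)}}$; one writes $\|\xi\|(m)=\sqrt{\langle\xi,\xi\rangle(m)}$. The section space $\Delta$ of a continuous field of Hilbert spaces is such a module, with $\langle\xi,\eta\rangle(m)=\langle\xi(m),\eta(m)\rangle$, and this gives an equivalence between continuous fields of Hilbert spaces over $M$ and Hilbert $C_0(M)$-modules. A continuous unitary representation of $G$ is a continuous field of Hilbert spaces $(\mathcal H,\Delta)$ with unitary operators $\pi(g):\mathcal H_{s(g)}\to\mathcal H_{t(g)}$ such that $\pi(1_m)=\mathrm{id}$, $\pi(gg')=\pi(g)\pi(g')$, $\pi(g^{-1})=\pi(g)^{-1}$, and $(g,h)\mapsto\pi(g)h$ is continuous $\{(g,h)\in G\times\mathcal H: s(g)=p(h)\}\to\mathcal H$. A global bisection of $G$ is a continuous map $\sigma:M\to G$ with $t\circ\sigma=\mathrm{id}_M$ and $\tilde\sigma:=s\circ\sigma:M\to M$ a homeomorphism; $\tilde\sigma^*f=f\circ\tilde\sigma$. The set $\mathrm{Bis}(G)$ of global bisections is a topological group under $(\sigma_1\cdot\sigma_2)(m)=\sigma_1(m)\sigma_2(\tilde\sigma_1(m))$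 with the compact-open topology, with subbasis the sets $U(K,V)=\{\sigma:\sigma(K)\subset V\}$, $K\subset M$ compact, $V\subset G$ open. A representation $\tilde\pi$ of $\mathrm{Bis}(G)$ on $\Delta$ is continuous if $(\sigma,\xi)\mapsto\tilde\pi(\sigma)\xi$ is continuous $\mathrm{Bis}(G)\times\Delta\to\Delta$, and $C_0(M)$-unitary if $\langle\tilde\pi(\sigma)\xi,\tilde\pi(\sigma)\eta\rangle=\langle\xi,\eta\rangle$ for all $\sigma\in\mathrm{Bis}(G)$ and $\xi,\eta\in\Delta$. $G\rightrightarrows M$ is bisectional if (1) every $g\in G$ is in the image of a global bisection, and (2) for all compact $K\subset M$ and open $V\subset G$, the set $\bigcup_{\sigma\in U(K,V)}\mathrm{im}(\sigma)\subset G$ is open.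
   Formalization: C_0(M)-unitarity is corrected to ⟨π̃(σ)ξ,π̃(σ)η⟩ = σ̃^*⟨ξ,η⟩; axiom (iii) of continuous fields is imposed only on sections with norm in C_0(M); that Bis(G) is a topological group is an explicit hypothesis; the bijection is between isomorphism classes. *)

(* Defs.v *)
From HB Require Import structures.
From mathcomp Require Import all_boot all_order all_algebra.
From mathcomp Require Import complex.
From mathcomp Require Import all_classical all_reals all_analysis.

Set Implicit Arguments.
Unset Strict Implicit.
Unset Printing Implicit Defensive.
Set Warnings "-redundant-canonical-projection".

Import Order.TTheory GRing.Theory Num.Theory.
Import numFieldNormedType.Exports.

Local Open Scope classical_set_scope.
Local Open Scope complex_scope.
Local Open Scope ring_scope.

(* The norm topology is only available on abstract numeric fields; the
   concrete type R[i] of complex numbers needs its own instances. *)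
HB.instance Definition _ (R : realType) :=
  PseudoPointedMetric.copy R[i] (R[i]^o).
HB.instance Definition _ (R : realType) := GRing.ComAlgebra.copy R[i] (R[i]^o).
HB.instance Definition _ (R : realType) := NormedModule.copy R[i] (R[i]^o).

Definition homeomorphism (X Y : topologicalType) (f : X -> Y) : Prop :=
  exists g : Y -> X, [/\ cancel f g, cancel g f, continuous f & continuous g].

Section C0.
Variables (R : realType) (M : topologicalType).

Definition vanishes_at_infinity (f : M -> R[i]) : Prop :=
  forall e : R[i], 0 < e ->
    exists2 K : set M, compact K & forall m, ~ K m -> `|f m| < e.

Definition is_C0 (f : M -> R[i]) : Prop :=
  continuous f /\ vanishes_at_infinity f.

Definition C0_pred : {pred M -> R[i]} := fun f => `[< is_C0 f >].

Lemma is_C0_0 : is_C0 0.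
Proof.
split; first by move=> x; exact: cvg_cst.
by move=> e e0; exists set0; [exact: compact0|move=> m _; rewrite normr0].
Qed.

Lemma is_C0D f g : is_C0 f -> is_C0 g -> is_C0 (f + g).
Proof.
move=> [fc f0] [gc g0]; split; first by move=> x; apply: cvgD; [exact: fc|exact: gc].
move=> e e0; have e2 : 0 < e / 2 by rewrite divr_gt0.
have [K cK fK] := f0 _ e2; have [L cL gL] := g0 _ e2.
exists (K `|` L); first exact: compactU.
move=> m nKL; rewrite (splitr e); apply: le_lt_trans (ler_normD _ _) _.
by apply: ltrD; [apply: fK|apply: gL] => ?; apply: nKL; [left|right].
Qed.

Lemma is_C0M f g : is_C0 f -> is_C0 g -> is_C0 (fun m => f m * g m).
Proof.
move=> [fc f0] [gc g0]; split.
  by move=> x; apply: cvgM; [exact: fc|exact: gc].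
move=> e e0; have [K cK fK] := f0 _ (@ltr01 R[i]); have [L cL gL] := g0 _ e0.
exists (K `|` L); first exact: compactU.
move=> m nKL; rewrite normrM -[e]mul1r.
by apply: ltr_pM => //; [apply: fK|apply: gL] => ?; apply: nKL; [left|right].
Qed.

Lemma is_C0Z (c : R[i]) f : is_C0 f -> is_C0 (c *: f).
Proof.
move=> [fc f0]; split.
  by move=> x; apply: (@cvgM _ _ _ _ (cst c)); [exact: cvg_cst|exact: fc].
move=> e e0; have c0 : 0 < 1 + `|c| by rewrite ltr_pwDl.
have [K cK fK] := f0 _ (divr_gt0 e0 c0); exists K => // m /fK.
rewrite ltr_pdivlMr// mulrC; apply: le_lt_trans.
by rewrite normrM ler_wpM2r// lerDr.
Qed.

Lemma is_C0_pullback (h : M -> M) f :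
  homeomorphism h -> is_C0 f -> is_C0 (f \o h).
Proof.
move=> [g [hK gK hc gc]] [fc f0]; split.
  by move=> x; apply: continuous_comp; [exact: hc|exact: fc].
move=> e e0; have [K cK fK] := f0 _ e0; exists (g @` K).
  by apply: continuous_compact => //; exact: continuous_subspaceT.
by move=> m nK; apply: fK => Khm; apply: nK; exists (h m).
Qed.

Lemma C0_submod_closed : submod_closed C0_pred.
Proof.
split=> [|c f g /asboolP f0 /asboolP g0]; apply/asboolP; first exact: is_C0_0.
by apply: is_C0D g0; exact: is_C0Z.
Qed.

HB.instance Definition _ :=
  GRing.isSubmodClosed.Build R[i] (M -> R[i]) C0_pred C0_submod_closed.

Record C0 := MkC0 { C0_fun :> M -> R[i]; C0_mem : C0_fun \in C0_pred }.
HB.instance Definition _ := [isSub for C0_fun].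
HB.instance Definition _ := [Choice of C0 by <:].
HB.instance Definition _ := [SubChoice_isSubLmodule of C0 by <:].

Lemma C0P (f : C0) : is_C0 f. Proof. exact/asboolP/C0_mem. Qed.

Definition C0_of (f : M -> R[i]) (f0 : is_C0 f) : C0 := MkC0 (asboolT f0).

Definition C0_mul (f g : C0) : C0 := C0_of (is_C0M (C0P f) (C0P g)).

Definition C0_pullback (h : M -> M) (hh : homeomorphism h) (f : C0) : C0 :=
  C0_of (is_C0_pullback hh (C0P f)).

Definition C0_norm (f : C0) : R := sup (range (fun m => complex.Re `|f m|)).

End C0.

Record hilbertSpace (R : realType) := HilbertSpace {
  hs_space :> completeNormedModType R[i];
  hs_dot : {dot hs_space for @Num.conj R[i]};
  hs_normE : forall x : hs_space, `|x| = sqrtC (hs_dot x x)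
}.

(* Inner products are linear in the second variable; the dot products of the
   library are linear in the first one. *)
Definition inner (R : realType) (H : hilbertSpace R) (x y : H) : R[i] :=
  hs_dot H y x.

Definition unitary_op (R : realType) (H K : hilbertSpace R) (U : H -> K) :
    Prop :=
  [/\ linear U, (forall x y, inner (U x) (U y) = inner x y) &
      forall z, exists x, U x = z].

(* In [cf_local] only sections whose norm is in C_0(M) are considered: without
   this restriction, on a non-compact M, C_0(M) would not be the section space
   of a constant field of lines, as the constant function 1 is locally a uniform
   limit of functions in C_0(M). *)
Record continuousField (R : realType) (M : topologicalType) := ContinuousField {
  cf_fibre :> M -> hilbertSpace R;
  cf_sections : set (forall m, cf_fibre m);
  cf_sections0 : cf_sections (fun m => 0);
  cf_sectionsP : forall (c : R[i]) xi eta,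
    cf_sections xi -> cf_sections eta ->
    cf_sections (fun m => c *: xi m + eta m);
  cf_total : forall m (h : cf_fibre m), exists2 xi, cf_sections xi & xi m = h;
  cf_norm_C0 : forall xi, cf_sections xi -> is_C0 (fun m => `|xi m| : R[i]);
  cf_local : forall xi : (forall m, cf_fibre m),
    is_C0 (fun m => `|xi m| : R[i]) ->
    (forall (e : R[i]) (m : M), 0 < e -> exists2 eta, cf_sections eta &
       \forall n \near m, `|xi n - eta n| < e) ->
    cf_sections xi
}.

Section TotalSpace.
Variables (R : realType) (M : topologicalType) (H : continuousField R M).

Record total_space := Total { tot_base : M; tot_vec : H tot_base }.

Definition tube (e : R[i]) (xi : forall m, H m) (V : set M) : set total_space :=
  [set h | V (tot_base h) /\ `|tot_vec h - xi (tot_base h)| < e].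

(* These sets form a basis, so taking them as a subbase gives the same
   topology. *)
Definition tubes : set (set total_space) :=
  [set A | exists e xi V, [/\ 0 < e, cf_sections xi, open V & A = tube e xi V]].

HB.instance Definition _ := gen_eqMixin total_space.
HB.instance Definition _ := gen_choiceMixin total_space.
HB.instance Definition _ := isSubBaseTopological.Build total_space tubes id.

End TotalSpace.

(* [mul g g'] is only meaningful when [src g = tgt g']. *)
Record topGroupoid (M : topologicalType) := TopGroupoid {
  arrows :> topologicalType;
  src : arrows -> M;
  tgt : arrows -> M;
  unt : M -> arrows;
  inv : arrows -> arrows;
  mul : arrows -> arrows -> arrows;
  src_unt : forall m, src (unt m) = m;
  tgt_unt : forall m, tgt (unt m) = m;
  src_inv : forall g, src (inv g) = tgt g;
  tgt_inv : forall g, tgt (inv g) = src g;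
  src_mul : forall g g', src g = tgt g' -> src (mul g g') = src g';
  tgt_mul : forall g g', src g = tgt g' -> tgt (mul g g') = tgt g;
  grpd_mulA : forall g g' g'', src g = tgt g' -> src g' = tgt g'' ->
    mul g (mul g' g'') = mul (mul g g') g'';
  grpd_mul1 : forall g, mul g (unt (src g)) = g;
  grpd_1mul : forall g, mul (unt (tgt g)) g = g;
  grpd_mulV : forall g, mul g (inv g) = unt (tgt g);
  grpd_Vmul : forall g, mul (inv g) g = unt (src g);
  src_continuous : continuous src;
  tgt_continuous : continuous tgt;
  unt_continuous : continuous unt;
  inv_continuous : continuous inv;
  mul_continuous : {within [set x : arrows * arrows | src x.1 = tgt x.2],
    continuous (fun x => mul x.1 x.2)}
}.

Section Bisections.
Variables (M : topologicalType) (G : topGroupoid M).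

Record bisection := Bisection {
  bis_fun :> M -> G;
  bis_continuous : continuous bis_fun;
  tgt_bis : forall m, tgt (bis_fun m) = m;
  bis_homeo : homeomorphism (fun m => src (bis_fun m))
}.

Definition bis_base (s : bisection) : M -> M := fun m => src (s m).

Lemma bisP (s s' : bisection) : (forall m, s m = s' m) -> s = s'.
Proof.
case: s s' => [s c t h] [s' c' t' h'] /= /funext e.
by case: _ / e c' t' h' => c' t' h'; congr Bisection; exact: Prop_irrelevance.
Qed.

Lemma mul_comp_continuous (f g : M -> G) :
  continuous f -> continuous g -> (forall m, src (f m) = tgt (g m)) ->
  continuous (fun m => mul (f m) (g m)).
Proof.
move=> fc gc fg x.
have /subspace_continuousP/(_ (f x, g x) (fg x)) := @mul_continuous M G.
apply: cvg_trans => A /= mA.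
have : (fun m => (f m, g m)) @ x --> (f x, g x).
  by apply: cvg_pair; [exact: fc|exact: gc].
move=> /(_ _ mA); rewrite /nbhs/=; apply: filterS => m /=; apply; exact: fg.
Qed.

Lemma homeomorphism_comp (X Y Z : topologicalType) (f : X -> Y) (g : Y -> Z) :
  homeomorphism f -> homeomorphism g -> homeomorphism (fun x => g (f x)).
Proof.
move=> [f' [fK f'K fc f'c]] [g' [gK g'K gc g'c]].
exists (fun z => f' (g' z)); split.
- by move=> x; rewrite gK fK.
- by move=> z; rewrite f'K g'K.
- by move=> x; apply: continuous_comp; [exact: fc|exact: gc].
- by move=> x; apply: continuous_comp; [exact: g'c|exact: f'c].
Qed.

Program Definition bis_one : bisection :=
  @Bisection (@unt M G) (@unt_continuous M G) (@tgt_unt M G) _.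
Next Obligation.
exists id; split; [move=> m|move=> m|move=> m|by move=> m; exact: cvg_id].
- by rewrite src_unt.
- by rewrite src_unt.
- by rewrite (_ : (fun m => _) = id); [exact: cvg_id|apply/funext/src_unt].
Qed.

Program Definition bis_mul (s1 s2 : bisection) : bisection :=
  @Bisection (fun m => mul (s1 m) (s2 (bis_base s1 m))) _ _ _.
Next Obligation.
move=> s1 s2; apply: mul_comp_continuous.
- exact: bis_continuous.
- have [_ [_ _ + _]] := bis_homeo s1 => s1c m.
  by apply: (continuous_comp (s1c m)); exact: bis_continuous.
- by move=> m; rewrite tgt_bis.
Qed.
Next Obligation.
by move=> s1 s2 m /=; rewrite tgt_mul tgt_bis// tgt_bis.
Qed.
Next Obligation.
move=> s1 s2; rewrite (_ : (fun m => _) =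
    fun m => bis_base s2 (bis_base s1 m)).
  by apply: homeomorphism_comp; exact: bis_homeo.
by apply/funext => m; rewrite src_mul ?tgt_bis.
Qed.

Definition bis_base_inv (s : bisection) : M -> M := projT1 (cid (bis_homeo s)).

Lemma bis_base_invP (s : bisection) :
  [/\ cancel (bis_base s) (bis_base_inv s), cancel (bis_base_inv s) (bis_base s),
      continuous (bis_base s) & continuous (bis_base_inv s)].
Proof. exact: projT2 (cid (bis_homeo s)). Qed.

Program Definition bis_inv (s : bisection) : bisection :=
  @Bisection (fun m => inv (s (bis_base_inv s m))) _ _ _.
Next Obligation.
move=> s m; have [_ _ _ c] := bis_base_invP s.
apply: (@continuous_comp _ _ _ (bis_base_inv s) (fun n => inv (s n))).
  exact: c.
apply: (@continuous_comp _ _ _ s (@inv M G)); first exact: bis_continuous.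
exact: inv_continuous.
Qed.
Next Obligation.
by move=> s m; have [_ K _ _] := bis_base_invP s; rewrite /= tgt_inv; exact: K.
Qed.
Next Obligation.
move=> s; have [K K' c c'] := bis_base_invP s; exists (bis_base s).
have -> : (fun m => src (inv (s (bis_base_inv s m)))) = bis_base_inv s.
  by apply/funext => m; rewrite src_inv tgt_bis.
by split.
Qed.

Lemma bis_mulA : associative bis_mul.
Proof.
move=> s1 s2 s3; apply: bisP => m /=.
rewrite /bis_base /= [in RHS]src_mul ?tgt_bis// grpd_mulA ?tgt_bis//.
Qed.

Lemma bis_mul1 : right_id bis_one bis_mul.
Proof. by move=> s; apply: bisP => m; rewrite /= /bis_base grpd_mul1. Qed.

Lemma bis_1mul : left_id bis_one bis_mul.
Proof.
move=> s; apply: bisP => m; rewrite /= /bis_base /= src_unt.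
by rewrite -{1}(tgt_bis s m) grpd_1mul.
Qed.

Lemma bis_mulV : right_inverse bis_one bis_inv bis_mul.
Proof.
move=> s; apply: bisP => m /=; have [K _ _ _] := bis_base_invP s.
by rewrite K grpd_mulV tgt_bis.
Qed.

Lemma bis_Vmul : left_inverse bis_one bis_inv bis_mul.
Proof.
move=> s; apply: bisP => m /=; have [_ K _ _] := bis_base_invP s.
rewrite /bis_base /= src_inv tgt_bis grpd_Vmul; congr unt; exact: K.
Qed.

HB.instance Definition _ := gen_eqMixin bisection.
HB.instance Definition _ := gen_choiceMixin bisection.
HB.instance Definition _ := isGroup.Build bisection
  bis_mulA bis_1mul bis_mul1 bis_Vmul bis_mulV.
HB.instance Definition _ := Topological.copy bisection
  (initial_topology (bis_fun : bisection -> {compact-open, M -> G})).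

(* Not automatic: for M locally compact Hausdorff the multiplication is
   continuous, but inversion need not be in the compact-open topology, e.g. for
   the pair groupoid of the Cantor set minus a point. *)
Definition bis_topological_group : Prop :=
  continuous (fun x : bisection * bisection => (x.1 * x.2)%g) /\
  continuous (fun s : bisection => s^-1%g).

Definition bis_nbhs (K : set M) (V : set G) : set bisection :=
  [set s : bisection | s @` K `<=` V].

Definition bisectional : Prop :=
  (forall g : G, exists (s : bisection) m, s m = g) /\
  (forall (K : set M) (V : set G), compact K -> open V ->
    open (\bigcup_(s in bis_nbhs K V) range s)).

End Bisections.

Section GroupoidRepresentations.
Variables (R : realType) (M : topologicalType) (G : topGroupoid M).

(* The fibred product {(g, h) | src g = p h} of G and the total space, with the
   subspace topology of the product. *)
Section FibredProduct.
Variable H : continuousField R M.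

Record fibred_product := Fibred { fp_arrow : G; fp_vec : H (src fp_arrow) }.

Definition fp_incl (x : fibred_product) : G * total_space H :=
  (fp_arrow x, Total (fp_vec x)).

HB.instance Definition _ := gen_eqMixin fibred_product.
HB.instance Definition _ := gen_choiceMixin fibred_product.
HB.instance Definition _ :=
  Topological.copy fibred_product (initial_topology fp_incl).

End FibredProduct.

(* [along op e e'] is [op g] with its source and target fibres transported
   along the equalities e and e'. *)
Definition along (H : M -> hilbertSpace R)
    (op : forall g : G, H (src g) -> H (tgt g))
    (g : G) (m n : M) (e : src g = m) (e' : tgt g = n) : H m -> H n :=
  match e in _ = m', e' in _ = n' return H m' -> H n' with
  | erefl, erefl => op g
  end.

Record unitaryRep := UnitaryRep {
  ur_field :> continuousField R M;
  ur_op : forall g : G, ur_field (src g) -> ur_field (tgt g);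
  ur_unitary : forall g, unitary_op (@ur_op g);
  ur_unt : forall m (h : ur_field m),
    along ur_op (src_unt G m) (tgt_unt G m) h = h;
  ur_mul : forall g g' (c : src g = tgt g') (h : ur_field (src g')),
    along ur_op (src_mul c) (tgt_mul c) h =
    along ur_op c erefl (ur_op h);
  ur_inv : forall g,
    cancel (@ur_op g) (along ur_op (src_inv g) (tgt_inv g)) /\
    cancel (along ur_op (src_inv g) (tgt_inv g)) (@ur_op g);
  ur_continuous : continuous (fun x : fibred_product ur_field =>
    Total (ur_op (fp_vec x)))
}.

Definition unitaryRep_iso (p p' : unitaryRep) : Prop :=
  exists U : forall m, p m -> p' m,
  [/\ forall m, unitary_op (U m),
      forall xi : (forall m, p m),
        cf_sections xi <-> cf_sections (fun m => U m (xi m)) &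
      forall (g : G) (h : p (src g)),
        U (tgt g) (ur_op h) = ur_op (U (src g) h)].

End GroupoidRepresentations.

Record hilbertModule (R : realType) (M : topologicalType) := HilbertModule {
  hm_space :> completeNormedModType R[i];
  hm_act : C0 R M -> hm_space -> hm_space;
  hm_ip : hm_space -> hm_space -> C0 R M;
  hm_act_linear : forall f, linear (hm_act f);
  hm_act_linearl : forall xi, linear (hm_act^~ xi);
  hm_actM : forall f g xi, hm_act (C0_mul f g) xi = hm_act f (hm_act g xi);
  hm_ip_linear : forall xi, linear (hm_ip xi);
  hm_ip_act : forall f xi eta,
    hm_ip xi (hm_act f eta) = C0_mul f (hm_ip xi eta);
  hm_ip_hermitian : forall xi eta m, hm_ip eta xi m = (hm_ip xi eta m)^*;
  hm_ip_ge0 : forall xi m, 0 <= hm_ip xi xi m;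
  hm_ip_definite : forall xi, hm_ip xi xi = 0 -> xi = 0;
  hm_normE : forall xi : hm_space,
    `|xi| = (Num.sqrt (C0_norm (hm_ip xi xi)))%:C
}.

Definition hm_norm_at (R : realType) (M : topologicalType)
  (D : hilbertModule R M) (xi : D) (m : M) : R[i] := sqrtC (hm_ip xi xi m).

Section BisectionRepresentations.
Variables (R : realType) (M : topologicalType) (G : topGroupoid M).

(* The operator of a bisection s covers the homeomorphism m |-> src (s m), so
   inner products are preserved up to pullback along it. Together with
   [br_C0_linear], the untwisted identity <t(s) xi, t(s) eta> = <xi, eta> would
   force <xi, eta> to vanish at every m with src (s m) <> m. *)
Record bisectionRep := BisectionRep {
  br_module :> hilbertModule R M;
  br_op : bisection G -> br_module -> br_module;
  br_linear : forall s, linear (br_op s);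
  br_one : forall xi, br_op 1%g xi = xi;
  br_mul : forall (s s' : bisection G) xi,
    br_op (s * s')%g xi = br_op s (br_op s' xi);
  br_continuous : continuous (fun x : bisection G * br_module => br_op x.1 x.2);
  br_unitary : forall (s : bisection G) xi eta,
    hm_ip (br_op s xi) (br_op s eta) = C0_pullback (bis_homeo s) (hm_ip xi eta);
  br_C0_linear : forall (s : bisection G) (f : C0 R M) xi,
    br_op s (hm_act f xi) = hm_act (C0_pullback (bis_homeo s) f) (br_op s xi);
  br_local : forall (s : bisection G) m xi,
    s m = unt G m -> hm_norm_at (br_op s xi - xi) m = 0
}.

Definition bisectionRep_iso (t t' : bisectionRep) : Prop :=
  exists Phi : t -> t',
  [/\ linear Phi /\ bijective Phi,
      forall f xi, Phi (hm_act f xi) = hm_act f (Phi xi),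
      forall xi eta, hm_ip (Phi xi) (Phi eta) = hm_ip xi eta &
      forall s xi, Phi (br_op s xi) = br_op s (Phi xi)].

(* Phi identifies the Hilbert module D with the section space of H. *)
Definition section_module_iso (D : hilbertModule R M) (H : continuousField R M)
    (Phi : D -> forall m, H m) : Prop :=
  [/\ forall (c : R[i]) xi eta m, Phi (c *: xi + eta) m = c *: Phi xi m + Phi eta m,
      forall f xi m, Phi (hm_act f xi) m = f m *: Phi xi m,
      forall xi eta m, hm_ip xi eta m = inner (Phi xi m) (Phi eta m) &
      range Phi = @cf_sections R M H].

(* t is the representation (t(s) xi)(m) = p(s(m)) xi(src (s m)) on sections. *)
Definition induced_by (p : unitaryRep R G) (t : bisectionRep) : Prop :=
  exists2 Phi : t -> forall m, p m, section_module_iso Phi &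
  forall (s : bisection G) xi m,
    Phi (br_op s xi) m =
    along (@ur_op _ _ _ p) erefl (tgt_bis s m) (Phi xi (src (s m))).

End BisectionRepresentations.

(* Main.v *)
(* A representation of the groupoid acts on sections by
   [(t(s) xi)(m) = p(s(m)) xi(src (s m))]. For the joint continuity in the sup
   norm, sections are small off a compact K, and the continuity of inversion in
   Bis(G) keeps the preimages of K under all bisections near [s] inside one
   compact L; on L one uses the continuity of the groupoid representation.

   Conversely, the fibre at [m] of a Hilbert module D is the quotient of D by the
   isotropic vectors of [<x, y>(m)], which is already complete as vectors lift
   with a bounded norm; that every local section comes from D is a partition of
   unity argument. By locality the class at [m] of [t(s) x] only depends on [s m]
   and on the class of [x] at [src (s m)], which defines the operator of the
   arrow [s m]. Bisections being sections of the target map, finite intersections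
   of the sets U(K, V) are again of this form, so that bisectionality turns the
   continuity of [t] into the continuity of the groupoid representation. *)

From HB Require Import structures.
From mathcomp Require Import all_boot all_order all_algebra.
From mathcomp Require Import complex finmap ring lra.
From mathcomp Require Import generic_quotient ring_quotient.
From mathcomp Require Import all_classical all_reals all_analysis.
Require Import Defs.

Set Implicit Arguments.
Unset Strict Implicit.
Unset Printing Implicit Defensive.

Import Order.TTheory GRing.Theory Num.Theory.
Import numFieldNormedType.Exports.

Local Open Scope classical_set_scope.
Local Open Scope complex_scope.
Local Open Scope ring_scope.

(** * Semi-inner products and Hilbert spaces *)

(** The two sides are compared only through the relation [induced_by]: isomorphisms are transferred
    in both directions between any two pairs it relates. Hence the correspondence up to isomorphism
    needs no explicit inverse: it is enough that every [t] is induced by some groupoid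
    representation. Three obstacles shape the rest. The norm of a module controls all of M at once
    while the compact-open topology only sees compact sets, which is why a whole neighbourhood of
    bisections has to pull K back into one compact set. The seminorm at a point is dominated by the
    module norm but not conversely, so completeness of a fibre is not inherited from the module and
    requires lifts of controlled norm. Finally, fibres form a dependent family in which endpoints of
    arrows agree only propositionally; equations are therefore transported by [along] and tested on
    values of sections, or moved to the total space, where the transports disappear. *)

Record semi_inner (R : realType) (V : lmodType R[i]) (q : V -> V -> R[i]) :
    Prop := SemiInner {
  si_linear : forall x a y z, q x (a *: y + z) = a * q x y + q x z;
  si_hermitian : forall x y, q y x = (q x y)^*;
  si_ge0 : forall x, 0 <= q x x
}.

Section SemiInnerTheory.
Variables (R : realType) (V : lmodType R[i]) (q : V -> V -> R[i]).
Hypothesis qP : semi_inner q.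

Definition seminorm (x : V) : R[i] := sqrtC (q x x).

Lemma si0r x : q x 0 = 0.
Proof. by have := si_linear qP x (-1) x x; rewrite scaleN1r addNr mulN1r addNr. Qed.

Lemma siDr x y z : q x (y + z) = q x y + q x z.
Proof. by have := si_linear qP x 1 y z; rewrite scale1r mul1r. Qed.

Lemma siZr a x y : q x (a *: y) = a * q x y.
Proof. by have := si_linear qP x a y 0; rewrite !addr0 si0r addr0. Qed.

Lemma siNr x y : q x (- y) = - q x y.
Proof. by rewrite -scaleN1r siZr mulN1r. Qed.

Lemma siDl x y z : q (x + y) z = q x z + q y z.
Proof. by rewrite !(si_hermitian qP z) siDr rmorphD. Qed.

Lemma siZl a x y : q (a *: x) y = a^* * q x y.
Proof. by rewrite !(si_hermitian qP y) siZr rmorphM. Qed.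

Lemma siNl x y : q (- x) y = - q x y.
Proof. by rewrite -scaleN1r siZl rmorphN rmorph1 mulN1r. Qed.

Lemma siD2 x y : q (x + y) (x + y) = q x x + q y y + (q x y + (q x y)^*).
Proof. by rewrite siDr !siDl -(si_hermitian qP x y); ring. Qed.

(* For [q x x = 0] the vector [y - t <x, y> x] has square norm
   [q y y - 2 t |<x, y>|^2]. *)
Lemma si_isotropic x y : q x x = 0 -> q x y = 0.
Proof.
move=> qx0; apply/eqP; apply/negPn/negP => c0.
set c := q x y in c0 *.
have n0 : 0 < `|c| ^+ 2 by rewrite exprn_gt0 ?normr_gt0.
have [t tR tE] : exists2 t, t^* = t & t * `|c| ^+ 2 = q y y + 1.
  exists ((q y y + 1) / `|c| ^+ 2); last by rewrite divfK ?gt_eqF.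
  by apply/CrealP; rewrite ger0_real// divr_ge0 ?ltW// ltr_wpDl ?(si_ge0 qP).
have := si_ge0 qP (y + (- (t * c)) *: x).
have -> : q (y + (- (t * c)) *: x) (y + (- (t * c)) *: x) = - (q y y + 2).
  rewrite siD2 siZl !siZr qx0 !mulr0 addr0 (si_hermitian qP x y) -/c.
  rewrite !(rmorphN, rmorphM) /= conjCK tR.
  transitivity (q y y - 2 * (t * `|c| ^+ 2)); first by rewrite normCK; ring.
  by rewrite tE; ring.
by rewrite oppr_ge0 lt_geF// ltr_wpDl ?(si_ge0 qP).
Qed.

Lemma seminorm_ge0 x : 0 <= seminorm x.
Proof. by rewrite sqrtC_ge0 (si_ge0 qP). Qed.

Lemma si_CauchySchwarz x y : `|q x y| <= seminorm x * seminorm y.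
Proof.
have [x0|x0] := eqVneq (q x x) 0.
  by rewrite si_isotropic// normr0 mulr_ge0 ?seminorm_ge0.
have qx0 : 0 < q x x by rewrite lt_neqAle eq_sym x0 (si_ge0 qP).
have qxR : (q x x)^* = q x x by rewrite -(si_hermitian qP).
rewrite -(@ler_pXn2r _ 2)// ?nnegrE ?mulr_ge0 ?seminorm_ge0//.
rewrite exprMn !sqrtCK -(ler_pM2l qx0) -subr_ge0.
(* The square norm of [q x x *: y - q x y *: x] is [q x x] times the difference
   [q x x * q y y - |q x y|^2], so positivity is the claim multiplied by [q x x]. *)
have := si_ge0 qP (q x x *: y + (- q x y) *: x).
congr (is_true (0 <= _)).
rewrite siD2 !siZl !siZr !(rmorphN, rmorphM) /= !(conjCK, qxR).
by rewrite (si_hermitian qP x y) normCK conjCK; ring.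
Qed.

Lemma seminormD x y : seminorm (x + y) <= seminorm x + seminorm y.
Proof.
rewrite -(@ler_pXn2r _ 2)// ?nnegrE ?addr_ge0 ?seminorm_ge0//.
rewrite sqrrD !sqrtCK siD2 -addrA [q y y + _]addrC addrA lerD2r lerD2l.
have := si_CauchySchwarz x y; rewrite -(ler_pMn2r (isT : 0 < 2)%N).
apply: le_trans; have := ler_normD (q x y) (q x y)^*.
rewrite norm_conjC -mulr2n; apply: le_trans; apply: real_ler_norm.
by apply/CrealP; rewrite rmorphD/= conjCK addrC.
Qed.

Lemma seminormZ a x : seminorm (a *: x) = `|a| * seminorm x.
Proof.
rewrite /seminorm siZl siZr mulrA [_^* * _]mulrC -normCK.
by rewrite sqrtCM ?nnegrE ?exprn_ge0 ?(si_ge0 qP)// sqrCK.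
Qed.

Lemma seminorm0 : seminorm 0 = 0. Proof. by rewrite /seminorm si0r sqrtC0. Qed.

Lemma seminormN x : seminorm (- x) = seminorm x.
Proof. by rewrite -scaleN1r seminormZ normrN1 mul1r. Qed.

Lemma seminormB x y : seminorm (x - y) = seminorm (y - x).
Proof. by rewrite -opprB seminormN. Qed.

Lemma seminorm_eq0 x : (seminorm x == 0) = (q x x == 0).
Proof. exact: sqrtC_eq0. Qed.

End SemiInnerTheory.

Section ComplexReals.
Variable R : realType.

Lemma ge0_real_complex (e : R[i]) : 0 <= e -> exists2 r : R, 0 <= r & e = r%:C.
Proof.
move=> e0; have /complex_realP [r er] : e \is Num.real by rewrite ger0_real.
by exists r => //; rewrite -lecR -er.
Qed.

Lemma gt0_real_complex (e : R[i]) : 0 < e -> exists2 r : R, 0 < r & e = r%:C.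
Proof.
move=> e0; have [r _ er] := ge0_real_complex (ltW e0).
by exists r => //; rewrite -ltcR -er.
Qed.

Lemma exists_inv_lt (e : R[i]) : 0 < e ->
  exists n, forall k, (n <= k)%N -> k.+1%:R^-1 < e.
Proof.
move=> /gt0_real_complex[r r0 ->].
have [n _ nP] := near_infty_natSinv_lt (PosNum r0).
by exists n => k /nP /=; rewrite -ltcR rmorphV ?unitfE//= rmorph_nat.
Qed.

End ComplexReals.

(** * Normed and Hilbert spaces built from sequentially complete norms and forms *)

Definition cauchy_seq (R : realType) (V : zmodType) (N : V -> R[i])
    (u : nat -> V) : Prop :=
  forall e, 0 < e -> exists n, forall i j, (n <= i)%N -> (n <= j)%N ->
    N (u i - u j) < e.

Definition seq_limit (R : realType) (V : zmodType) (N : V -> R[i])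
    (u : nat -> V) (x : V) : Prop :=
  forall e, 0 < e -> exists n, forall i, (n <= i)%N -> N (u i - x) < e.

Record complete_norm (R : realType) (V : lmodType R[i]) := CompleteNorm {
  cn_norm :> V -> R[i];
  cn_normD : forall x y, cn_norm (x + y) <= cn_norm x + cn_norm y;
  cn_normZ : forall a x, cn_norm (a *: x) = `|a| * cn_norm x;
  cn_eq0 : forall x, cn_norm x = 0 -> x = 0;
  cn_complete : forall u, cauchy_seq cn_norm u -> exists x, seq_limit cn_norm u x
}.

(** The phantom argument [N] makes the type remember the chosen norm, so that the structures
    inferred on it can depend on [N]. *)
Definition normed_copy (R : realType) (V : lmodType R[i])
  (N : complete_norm V) : Type := V.

Section NormedCopy.
Variables (R : realType) (V : lmodType R[i]) (N : complete_norm V).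

HB.instance Definition _ := GRing.Lmodule.copy (normed_copy N) V.
HB.instance Definition _ := Lmodule_isNormed.Build R[i] (normed_copy N)
  (cn_normD N) (cn_normZ N) (cn_eq0 (c := N)).

(** A Cauchy filter contains a ball of radius 1/(k+1) for every k. Two such balls meet because the
    filter is proper, so the centres form a Cauchy sequence, and its limit is a limit of the
    filter. *)
Lemma normed_copy_cauchy_cvg (F : set_system (normed_copy N)) :
  ProperFilter F -> cauchy F -> cvg F.
Proof.
move=> FF /cauchyP Fc.
have /choice[y yP] k : exists y : normed_copy N, F (ball y k.+1%:R^-1).
  by apply: Fc; rewrite invr_gt0 ltr0Sn.
have yN i j : `|y i - y j| < i.+1%:R^-1 + j.+1%:R^-1.
  have /filter_ex[z [/= zi zj]] : F (ball (y i) i.+1%:R^-1 `&` ball (y j) j.+1%:R^-1).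
    exact: filterI.
  rewrite -(subrK z (y i)) -addrA; apply: le_lt_trans (ler_normD _ _) _.
  by apply: ltrD; [|rewrite distrC]; move: zi zj; rewrite -!ball_normE.
have [e e0|x yx] := @cn_complete _ _ N y.
  have [n nP] := exists_inv_lt (divr_gt0 e0 (ltr0Sn R[i] 1)).
  exists n => i j ni nj; apply: lt_trans (yN i j) _.
  by rewrite [ltRHS]splitr ltrD ?nP.
apply/cvg_ex; exists x; apply/cvgrPdist_lt => e e0.
have e2 := divr_gt0 e0 (ltr0Sn R[i] 1).
have [n nP] := exists_inv_lt e2; have [m mP] := yx _ e2.
apply: filterS (yP (maxn n m)) => z; rewrite -ball_normE /= => zy.
rewrite -(subrK (y (maxn n m)) x) -addrA.
apply: le_lt_trans (ler_normD _ _) _; rewrite [ltRHS]splitr ltrD//.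
  by rewrite distrC; apply: mP; rewrite leq_maxr.
by apply: lt_trans zy _; apply: nP; rewrite leq_maxl.
Qed.

HB.instance Definition _ := Uniform_isComplete.Build (normed_copy N)
  normed_copy_cauchy_cvg.

End NormedCopy.

Record complete_form (R : realType) (V : lmodType R[i]) := CompleteForm {
  form :> V -> V -> R[i];
  form_semi_inner : semi_inner form;
  form_definite : forall x, form x x = 0 -> x = 0;
  form_complete : forall u, cauchy_seq (seminorm form) u ->
    exists x, seq_limit (seminorm form) u x
}.

Section FormHilbert.
Variables (R : realType) (V : lmodType R[i]) (q : complete_form V).
Let qP := form_semi_inner q.

Lemma form_norm_eq0 x : seminorm q x = 0 -> x = 0.
Proof. by move=> /eqP; rewrite seminorm_eq0 => /eqP; exact: form_definite. Qed.

Definition form_norm : complete_norm V :=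
  CompleteNorm (seminormD qP) (seminormZ qP) form_norm_eq0 (@form_complete _ _ q).

Definition form_dot (x y : normed_copy form_norm) : R[i] := q y x.

Lemma form_dot_bilinear :
  bilinear_for *%R (Num.conj \; *%R) form_dot.
Proof.
split=> [y a x x'|x a y y']; first by rewrite /form_dot (si_linear qP).
by rewrite /form_dot siDl// siZl.
Qed.

HB.instance Definition _ :=
  bilinear_isBilinear.Build _ _ _ _ _ _ form_dot form_dot_bilinear.

Lemma form_dot_hermitian x y :
  form_dot x y = (-1) ^+ false * (form_dot y x)^*.
Proof. by rewrite mul1r -(si_hermitian qP). Qed.

HB.instance Definition _ :=
  isHermitianSesquilinear.Build _ _ _ _ form_dot form_dot_hermitian.

Lemma form_dot_gt0 x : x != 0 -> 0 < form_dot x x.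
Proof.
move=> x0; rewrite lt_neqAle (si_ge0 qP) andbT eq_sym.
by apply: contra_neq x0; exact: form_definite.
Qed.

HB.instance Definition _ := isDotProduct.Build _ _ form_dot form_dot_gt0.

Definition form_hilbert : hilbertSpace R :=
  @HilbertSpace R (normed_copy form_norm) form_dot (fun=> erefl).

End FormHilbert.

(** * The Hilbert space quotient of a complete semi-inner product by its isotropic vectors *)

Record complete_semi_form (R : realType) (V : lmodType R[i]) := CompleteSemiForm {
  semi_form :> V -> V -> R[i];
  semi_formP : semi_inner semi_form;
  semi_form_complete : forall u, cauchy_seq (seminorm semi_form) u ->
    exists x, seq_limit (seminorm semi_form) u x
}.

Section IsotropicQuotient.
Local Open Scope quotient_scope.
Variables (R : realType) (V : lmodType R[i]) (q : complete_semi_form V).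
Let qP := semi_formP q.

Definition isotropic : {pred V} := fun x => q x x == 0.

Lemma isotropicP x : reflect (q x x = 0) (x \in isotropic).
Proof. exact: eqP. Qed.

Lemma isotropic_zmod_closed : zmod_closed isotropic.
Proof.
split=> [|x y /isotropicP x0 /isotropicP y0]; apply/isotropicP.
  by rewrite si0r.
have qx := si_isotropic qP _ x0; have qy := si_isotropic qP _ y0.
by rewrite (siDr qP) (siNr qP) !(siDl qP) !(siNl qP) !qx !qy !(addr0, oppr0).
Qed.

HB.instance Definition _ :=
  GRing.isZmodClosed.Build V isotropic isotropic_zmod_closed.

Definition isotropic_quot : Type := Quotient.quot isotropic.

HB.instance Definition _ := GRing.Zmodule.on isotropic_quot.

Definition quot_pi (x : V) : isotropic_quot := \pi_(Quotient.quot isotropic) x.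

Definition quot_repr (h : isotropic_quot) : V :=
  repr (h : Quotient.quot isotropic).

Lemma quot_reprK : cancel quot_repr quot_pi.
Proof. by move=> h; rewrite /quot_pi reprK. Qed.

Lemma quot_piB : {morph quot_pi : x y / x - y}.
Proof. exact: pi_is_zmod_morphism. Qed.

Lemma quot_piD : {morph quot_pi : x y / x + y}.
Proof. exact: (raddfD (\pi_(Quotient.quot isotropic))). Qed.

Lemma quot_pi_eq x y : quot_pi x = quot_pi y <-> q (x - y) (x - y) = 0.
Proof.
split=> [/eqP|/eqP xy].
  by rewrite piE Quotient.equivE => /isotropicP.
by apply/eqP; rewrite piE Quotient.equivE; apply/isotropicP/eqP.
Qed.

Lemma quot_repr_pi x : q (quot_repr (quot_pi x) - x) (quot_repr (quot_pi x) - x) = 0.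
Proof. by apply/quot_pi_eq; rewrite quot_reprK. Qed.

Lemma form_quot x y : q (quot_repr (quot_pi x)) (quot_repr (quot_pi y)) = q x y.
Proof.
set x' := quot_repr _; set y' := quot_repr _.
have qx z : q (x' - x) z = 0 := si_isotropic qP z (quot_repr_pi x).
have qy z : q z (y' - y) = 0.
  by rewrite (si_hermitian qP) (si_isotropic qP z (quot_repr_pi y)) conjC0.
rewrite -(subrK x x') (siDl qP) qx add0r.
by rewrite -(subrK y y') (siDr qP) qy add0r.
Qed.

(** The quotient is first one of additive groups only; scalars act through representatives, and
    [quot_scale_pi] shows independence of the choice. *)
Definition quot_scale (a : R[i]) (h : isotropic_quot) : isotropic_quot :=
  quot_pi (a *: quot_repr h).

Lemma quot_scale_pi a x : quot_scale a (quot_pi x) = quot_pi (a *: x).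
Proof.
apply/quot_pi_eq; rewrite -scalerBr (siZl qP) (siZr qP).
by rewrite quot_repr_pi !mulr0.
Qed.

Lemma quot_scaleA a b h : quot_scale a (quot_scale b h) = quot_scale (a * b) h.
Proof. by rewrite -[h]quot_reprK !quot_scale_pi scalerA. Qed.

Lemma quot_scale1 : left_id 1 quot_scale.
Proof. by move=> h; rewrite -[h]quot_reprK quot_scale_pi scale1r. Qed.

Lemma quot_scaleDr : right_distributive quot_scale +%R.
Proof.
move=> a h k; rewrite -[h]quot_reprK -[k]quot_reprK -quot_piD.
by rewrite !quot_scale_pi -quot_piD scalerDr.
Qed.

Lemma quot_scaleDl h : {morph quot_scale^~ h : a b / a + b}.
Proof.
by move=> a b; rewrite -[h]quot_reprK !quot_scale_pi -quot_piD scalerDl.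
Qed.

HB.instance Definition _ := GRing.Zmodule_isLmodule.Build R[i] isotropic_quot
  quot_scaleA quot_scale1 quot_scaleDr quot_scaleDl.

Lemma quot_piP a x y : quot_pi (a *: x + y) = a *: quot_pi x + quot_pi y.
Proof. by rewrite quot_piD -quot_scale_pi. Qed.

Definition quot_form (h k : isotropic_quot) : R[i] :=
  q (quot_repr h) (quot_repr k).

Lemma quot_form_pi x y : quot_form (quot_pi x) (quot_pi y) = q x y.
Proof. exact: form_quot. Qed.

Lemma quot_form_semi_inner : semi_inner quot_form.
Proof.
split=> [x a y z|x y|x]; last exact: (si_ge0 qP).
  rewrite -[x]quot_reprK -[y]quot_reprK -[z]quot_reprK -quot_piP.
  by rewrite !quot_form_pi (si_linear qP).
exact: (si_hermitian qP).
Qed.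

Lemma quot_form_definite h : quot_form h h = 0 -> h = 0.
Proof.
rewrite -[h]quot_reprK quot_form_pi => h0; rewrite -[RHS](subrr (quot_pi 0)) -quot_piB.
by apply/quot_pi_eq; rewrite !subr0.
Qed.

Lemma quot_form_complete u : cauchy_seq (seminorm quot_form) u ->
  exists h, seq_limit (seminorm quot_form) u h.
Proof.
have E x y : seminorm quot_form (quot_pi x - y) = seminorm q (x - quot_repr y).
  by rewrite -{1}[y]quot_reprK -quot_piB /seminorm quot_form_pi.
move=> uc; have [e /uc[n nP]|x xP] := @semi_form_complete _ _ q (quot_repr \o u).
  by exists n => i j /nP{}nP /nP; rewrite -(quot_reprK (u i)) E.
exists (quot_pi x) => e /xP[n nP]; exists n => i /nP /=.
by rewrite (seminormB quot_form_semi_inner) E (seminormB qP).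
Qed.

Definition quot_hilbert : hilbertSpace R :=
  form_hilbert (CompleteForm quot_form_semi_inner quot_form_definite
    quot_form_complete).

End IsotropicQuotient.

Lemma hilbert_quotient (R : realType) (V : lmodType R[i])
    (q : complete_semi_form V) :
  exists (H : hilbertSpace R) (pi : V -> H),
  [/\ linear pi, (forall h, exists x, pi x = h) &
      forall x y, inner (pi x) (pi y) = q x y].
Proof.
exists (quot_hilbert q), (@quot_pi _ _ q); split.
- by move=> a x y; exact: quot_piP.
- by move=> h; exists (quot_repr h); exact: quot_reprK.
- exact: quot_form_pi.
Qed.

(** * Functions vanishing at infinity *)

Section C0Theory.
Variables (R : realType) (M : topologicalType).
Implicit Types f g : M -> R[i].

Lemma continuousC_P f (x : M) : {for x, continuous f} <->
  forall e : R[i], 0 < e -> \forall y \near x, `|f x - f y| < e.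
Proof. exact: cvgrPdist_lt. Qed.

Lemma continuous_Re_norm f : continuous f -> continuous (fun m => complex.Re `|f m|).
Proof.
move=> fc x; apply/cvgrPdist_lt => e e0.
have /continuousC_P/(_ e%:C) := fc x; rewrite ltcR => /(_ e0).
apply: filterS => y; rewrite -ltcR; apply: le_lt_trans.
have E (z : R[i]) : `|z| = (complex.Re `|z|)%:C by rewrite RRe_real// normr_real.
apply: le_trans (ler_dist_dist (f x) (f y)).
rewrite [X in _ <= `|X - _|]E [X in _ <= `|_ - X|]E -rmorphB/=.
by rewrite normc_def /= expr0n addr0 sqrtr_sqr.
Qed.

Lemma is_C0_bounded f : is_C0 f -> exists r : R, forall m, `|f m| <= r%:C.
Proof.
move=> [fc f0]; have [K cK fK] := f0 1 ltr01.
have gc := continuous_Re_norm fc.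
have : compact ((fun m => complex.Re `|f m|) @` K).
  by apply: continuous_compact => //; exact: continuous_subspaceT.
move=> /compact_bounded[r [_ /(_ (r + 1))]]; rewrite ltrDl ltr01 => /(_ isT) rP.
exists (Num.max 1 (r + 1)) => m.
have [Km|nKm] := pselect (K m).
  have := rP _ (ex_intro2 _ _ m Km erefl).
  rewrite -(RRe_real (normr_real (f m))) lecR le_max => h; apply/orP; right.
  exact: le_trans (ler_norm _) h.
by apply: le_trans (ltW (fK _ nKm)) _; rewrite lecR le_max lexx.
Qed.

Lemma C0_norm_ge (f : C0 R M) m : `|f m| <= (C0_norm f)%:C.
Proof.
have [r rP] := is_C0_bounded (C0P f).
rewrite -(RRe_real (normr_real (f m))) lecR; apply: sup_upper_bound.
  split; first by exists (complex.Re `|f m|), m.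
  exists r => _ [n _ <-]; rewrite -lecR RRe_real ?normr_real//.
by exists m.
Qed.

Lemma C0_norm_le (f : C0 R M) (r : R) : 0 <= r ->
  (forall m, `|f m| <= r%:C) -> C0_norm f <= r.
Proof.
move=> r0 fr; rewrite /C0_norm; set A := (X in sup X <= _).
(* When M is empty the supremum is 0 by convention, and the bound comes from [0 <= r]. *)
have [->|/set0P ne] := eqVneq A set0; first by rewrite sup0.
apply: ge_sup => // _ [m _ <-].
by rewrite -lecR RRe_real ?normr_real.
Qed.

Lemma is_C0_limit f :
  (forall e : R[i], 0 < e -> exists2 g, is_C0 g & forall m, `|f m - g m| < e) ->
  is_C0 f.
Proof.
move=> fg; split=> [m|e e0].
  apply/continuousC_P => e e0; have e3 : 0 < e / 3 by rewrite divr_gt0.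
  have [g [gc _] gP] := fg _ e3; have /continuousC_P/(_ _ e3) := gc m.
  apply: filterS => n gmn.
  have -> : f m - f n = (f m - g m) + (g m - g n) - (f n - g n) by ring.
  have -> : e = e / 3 + e / 3 + e / 3 by field.
  apply: le_lt_trans (ler_normB _ _) _; rewrite ltrD//.
  by apply: le_lt_trans (ler_normD _ _) _; rewrite ltrD.
have e2 : 0 < e / 2 by rewrite divr_gt0.
have [g [_ g0] gP] := fg _ e2; have [K cK gK] := g0 _ e2; exists K => // m /gK gm.
by rewrite -(subrK (g m) (f m)) [ltRHS]splitr (le_lt_trans (ler_normD _ _))// ltrD.
Qed.

(** Since |sqrt x - sqrt y| <= sqrt x + sqrt y, the square is at most the product of the two, which
    is |x - y|. The modulus of continuity is uniform, with no special case at 0. *)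
Lemma sqrtC_dist (x y : R[i]) : 0 <= x -> 0 <= y ->
  `|sqrtC x - sqrtC y| ^+ 2 <= `|x - y|.
Proof.
move=> x0 y0; have sx : 0 <= sqrtC x by rewrite sqrtC_ge0.
have sy : 0 <= sqrtC y by rewrite sqrtC_ge0.
rewrite -[in leRHS](sqrtCK x) -[in leRHS](sqrtCK y) subr_sqr normrM expr2.
apply: ler_wpM2l => //; rewrite [leRHS]ger0_norm ?addr_ge0//.
by rewrite (le_trans (ler_normB _ _))// !ger0_norm.
Qed.

Lemma is_C0_sqrt f : is_C0 f -> (forall m, 0 <= f m) ->
  is_C0 (fun m => sqrtC (f m)).
Proof.
move=> [fc f0] fge; split=> [m|e e0].
  apply/continuousC_P => e e0; have e2 : 0 < e ^+ 2 by rewrite exprn_gt0.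
  have /continuousC_P/(_ _ e2) := fc m; apply: filterS => n fmn.
  rewrite -(@ltr_pXn2r _ 2)// ?nnegrE// ?(ltW e0)//.
  exact: le_lt_trans (sqrtC_dist _ _) fmn.
have e2 : 0 < e ^+ 2 by rewrite exprn_gt0.
have [K cK fK] := f0 _ e2; exists K => // m /fK.
rewrite !ger0_norm ?sqrtC_ge0// -[X in X < _ -> _]sqrtCK.
by rewrite ltr_pXn2r// nnegrE ?sqrtC_ge0// ltW.
Qed.

Lemma is_C0_sum (I : Type) (r : seq I) (F : I -> M -> R[i]) :
  (forall i, is_C0 (F i)) -> is_C0 (fun m => \sum_(i <- r) F i m).
Proof.
move=> FC; elim: r => [|i r IH].
  by rewrite (_ : (fun _ => _) = 0) ?funeqE => [|m]; [exact: is_C0_0|rewrite big_nil].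
rewrite (_ : (fun _ => _) = F i + (fun m => \sum_(j <- r) F j m)).
  exact: is_C0D.
by apply/funext => m; rewrite big_cons.
Qed.

Lemma C0_sqrt_norm_ge (f : C0 R M) m : (forall m, 0 <= f m) ->
  sqrtC (f m) <= (Num.sqrt (C0_norm f))%:C.
Proof.
move=> f0; rewrite -(@ler_pXn2r _ 2)// ?nnegrE ?sqrtC_ge0 ?lecR ?sqrtr_ge0//.
rewrite sqrtCK -rmorphXn/= sqr_sqrtr; last first.
  by rewrite -lecR; apply: le_trans (C0_norm_ge f m); exact: normr_ge0.
by rewrite (le_trans _ (C0_norm_ge _ m))// ger0_norm.
Qed.

Lemma C0_sqrt_norm_le (f : C0 R M) (e : R[i]) : (forall m, 0 <= f m) ->
  0 <= e -> (forall m, sqrtC (f m) <= e) -> (Num.sqrt (C0_norm f))%:C <= e.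
Proof.
move=> f0 /ge0_real_complex[r r0 ->] fr; rewrite lecR.
rewrite -[leRHS](ger0_norm r0) -sqrtr_sqr ler_wsqrtr// C0_norm_le ?sqr_ge0// => m.
rewrite ger0_norm// -[leLHS]sqrtCK rmorphXn/=.
by rewrite ler_pXn2r ?nnegrE ?sqrtC_ge0 ?lecR.
Qed.

End C0Theory.

(** * Hilbert modules and continuous fields *)

Section HilbertModuleTheory.
Variables (R : realType) (M : topologicalType) (D : hilbertModule R M).
Implicit Types (x y : D) (m : M).

Lemma hm_ip_semi_inner m : semi_inner (fun x y : D => hm_ip x y m).
Proof.
split=> [x a y z|x y|x]; last exact: hm_ip_ge0.
  by rewrite (hm_ip_linear x).
exact: hm_ip_hermitian.
Qed.

Lemma hm_norm_at0 m : hm_norm_at (0 : D) m = 0.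
Proof. exact: (seminorm0 (hm_ip_semi_inner m)). Qed.

Lemma hm_norm_atD x y m : hm_norm_at (x + y) m <= hm_norm_at x m + hm_norm_at y m.
Proof. exact: (seminormD (hm_ip_semi_inner m)). Qed.

Lemma hm_norm_atN x m : hm_norm_at (- x) m = hm_norm_at x m.
Proof. exact: (seminormN (hm_ip_semi_inner m)). Qed.

Lemma hm_norm_atB x y m : hm_norm_at (x - y) m = hm_norm_at (y - x) m.
Proof. exact: (seminormB (hm_ip_semi_inner m)). Qed.

Lemma hm_norm_at_ge0 x m : 0 <= hm_norm_at x m.
Proof. exact: (seminorm_ge0 (hm_ip_semi_inner m)). Qed.

Lemma hm_norm_atK x m : hm_norm_at x m ^+ 2 = hm_ip x x m.
Proof. exact: sqrtCK. Qed.

Lemma hm_norm_at_le x m : hm_norm_at x m <= `|x|.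
Proof. by rewrite hm_normE C0_sqrt_norm_ge//; exact: hm_ip_ge0. Qed.

Lemma hm_norm_le x (e : R[i]) : 0 <= e ->
  (forall m, hm_norm_at x m <= e) -> `|x| <= e.
Proof. by move=> e0 xe; rewrite hm_normE C0_sqrt_norm_le//; exact: hm_ip_ge0. Qed.

Lemma hm_norm_at_C0 x : is_C0 (hm_norm_at x).
Proof. by apply: is_C0_sqrt; [exact: C0P|exact: hm_ip_ge0]. Qed.

Lemma hm_norm_at_continuous x : continuous (hm_norm_at x).
Proof. by have [] := hm_norm_at_C0 x. Qed.

Lemma hm_norm_at_act f x m : hm_norm_at (hm_act f x) m = `|f m| * hm_norm_at x m.
Proof.
rewrite /hm_norm_at hm_ip_act /= hm_ip_hermitian hm_ip_act /=.
rewrite rmorphM/= -hm_ip_hermitian mulrA -normCK.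
by rewrite sqrtCM ?nnegrE ?exprn_ge0 ?hm_ip_ge0// sqrCK.
Qed.

End HilbertModuleTheory.

Section InnerTheory.
Variables (R : realType) (H : hilbertSpace R).
Implicit Types x y : H.

Lemma inner_semi_inner : semi_inner (@inner R H).
Proof.
split=> [x a y z|x y|x]; rewrite /inner.
- by rewrite linearPl.
- by rewrite hermC mul1r.
- exact: dnorm_ge0.
Qed.

Lemma inner_norm x : inner x x = `|x| ^+ 2.
Proof. by rewrite hs_normE sqrtCK. Qed.

Lemma norm_seminorm x : `|x| = seminorm (@inner R H) x.
Proof. exact: hs_normE. Qed.

(** A polarization identity with two mixed terms instead of four. It expresses inner products of
    sections by norms of sections, the only functions that the axioms of a continuous field declare
    to be in C_0(M). *)
Lemma inner_polarization x y : inner x y =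
  2^-1 * (`|x + y| ^+ 2 - 'i * `|x + 'i *: y| ^+ 2
          - (1 - 'i) * (`|x| ^+ 2 + `|y| ^+ 2)).
Proof.
have iP := inner_semi_inner.
rewrite -!inner_norm !(siD2 iP) !(siZl iP) !(siZr iP) rmorphM/= conjCi.
set c := inner x y; set a := inner x x; set b := inner y y.
have i2 := @sqrCi R[i]; rewrite expr2 in i2.
have -> : - 'i * ('i * b) = - ('i * 'i) * b :> R[i] by ring.
set d := _^*; rewrite i2.
transitivity (2^-1 * (c + d - ('i * 'i) * (c - d))); first by rewrite i2; field.
by congr (_ * _); ring.
Qed.

End InnerTheory.

Section FieldTheory.
Variables (R : realType) (M : topologicalType) (H : continuousField R M).
Implicit Types xi eta : forall m, H m.

Lemma cf_sectionsZ (c : R[i]) xi : cf_sections xi ->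
  cf_sections (fun m => c *: xi m).
Proof.
move=> xiS; have := cf_sectionsP c xiS (cf_sections0 H).
by congr cf_sections; apply: functional_extensionality_dep => m; rewrite addr0.
Qed.

Lemma cf_sectionsD xi eta : cf_sections xi -> cf_sections eta ->
  cf_sections (fun m => xi m + eta m).
Proof.
move=> xiS etaS; have := cf_sectionsP 1 xiS etaS.
by congr cf_sections; apply: functional_extensionality_dep => m; rewrite scale1r.
Qed.

Lemma cf_sectionsN xi : cf_sections xi -> cf_sections (fun m => - xi m).
Proof.
move=> /(cf_sectionsZ (-1)).
by congr cf_sections; apply: functional_extensionality_dep => m; rewrite scaleN1r.
Qed.

Lemma cf_sectionsB xi eta : cf_sections xi -> cf_sections eta ->
  cf_sections (fun m => xi m - eta m).
Proof. by move=> xiS /cf_sectionsN; exact: cf_sectionsD. Qed.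

Lemma cf_norm_continuous xi : cf_sections xi -> continuous (fun m => `|xi m| : R[i]).
Proof. by move=> /cf_norm_C0[]. Qed.

Lemma cf_inner_C0 xi eta : cf_sections xi -> cf_sections eta ->
  is_C0 (fun m => inner (xi m) (eta m)).
Proof.
move=> xiS etaS.
have sq (z : forall m, H m) : cf_sections z -> is_C0 (fun m => `|z m| ^+ 2 : R[i]).
  by move=> /cf_norm_C0 zC; exact: (is_C0M zC zC).
rewrite (_ : (fun _ => _) = 2^-1 *: ((fun m => `|xi m + eta m| ^+ 2 : R[i])
  + (- 'i) *: (fun m => `|xi m + 'i *: eta m| ^+ 2 : R[i])
  + (- (1 - 'i)) *: ((fun m => `|xi m| ^+ 2 : R[i]) + (fun m => `|eta m| ^+ 2 : R[i])))).
  apply: is_C0Z; apply: is_C0D; first apply: is_C0D.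
  - exact/sq/cf_sectionsD.
  - exact/is_C0Z/sq/cf_sectionsD/cf_sectionsZ.
  - by apply: is_C0Z; apply: is_C0D; exact: sq.
by apply/funext => m; rewrite inner_polarization -!mulNr.
Qed.

(** Near a point m the section [f xi] is approximated by the scalar multiple [f m *: xi], so
    [cf_local] applies. The factor [|xi m| + 1] bounds [|xi n|] for n near m. *)
Lemma cf_sections_act (f : C0 R M) xi : cf_sections xi ->
  cf_sections (fun m => f m *: xi m).
Proof.
move=> xiS; have nC := cf_norm_C0 xiS.
have [fc f0] := C0P f.
apply: cf_local => [|e m e0].
  rewrite (_ : (fun _ => _) = fun m => `|f m| * `|xi m|); last first.
    by apply/funext => m; rewrite normrZ.
  apply: is_C0M nC; split=> [m|e /f0[K cK fK]].
    exact: (continuous_comp (fc m) (@norm_continuous _ _ _)).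
  by exists K => // m /fK; rewrite normr_id.
exists (fun n => f m *: xi n); first exact: cf_sectionsZ.
have d0 : 0 < `|xi m| + 1 by rewrite ltr_wpDl.
have /continuousC_P/(_ _ (divr_gt0 e0 d0)) := fc m.
have /continuousC_P/(_ _ ltr01) := (cf_norm_continuous xiS) m.
apply: filterS2 => n xin fn.
rewrite -scalerBl normrZ distrC.
apply: le_lt_trans (_ : _ <= `|f m - f n| * (`|xi m| + 1)) _.
  rewrite ler_wpM2l// -lerBlDl.
  have R1 : `|xi n| - `|xi m| \is Num.real by rewrite realB.
  by rewrite (le_trans (real_ler_norm R1))// distrC ltW.
by rewrite -ltr_pdivlMr.
Qed.

End FieldTheory.

(** * Topology of the total space and of the group of bisections *)

Lemma initial_cvg (S : choiceType) (T : topologicalType) (f : S -> T)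
    (F : set_system S) (s : S) : Filter F ->
  f @ F --> f s -> F --> (s : initial_topology f).
Proof.
move=> FF Ff A [_ [[B Bo <-] Bs BA]]; apply: filterS BA _.
by apply: Ff; exact: open_nbhs_nbhs.
Qed.

Lemma compact_interior_cover (M : topologicalType) (K : set M) :
  locally_compact [set: M] -> compact K ->
  exists2 L : set M, compact L & K `<=` L°.
Proof.
move=> lcM /compact_near_coveringP Kc.
(* The filter of large compact sets: a point is interior to every L containing a compact
   neighbourhood of it, so near covering gives one L that works for all of K. *)
pose F := filter_from (@compact M) (fun L0 => [set L | compact L /\ L0 `<=` L]).
have FF : Filter F.
  apply: filter_from_filter; first by exists set0; exact: compact0.
  move=> L L' cL cL'; exists (L `|` L'); first exact: compactU.
  by move=> A [cA]; rewrite subUset => -[LA L'A].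
have [|L0 cL0 LP] := Kc _ F (fun L x => compact L /\ L° x) FF.
  move=> x Kx; have [U] := lcM x I; rewrite withinET => Ux [cU _].
  exists (U°, [set L | compact L /\ U `<=` L]) => /=.
    split; first exact: nbhs_interior.
    by exists U.
  by move=> [y L] [/= Uy [cL UL]]; split => //; exact: interiorS Uy.
have KL0 := LP L0 (conj cL0 (@subset_refl _ _)).
by exists L0 => // x /KL0[].
Qed.

Section TotalSpaceTopology.
Variables (R : realType) (M : topologicalType) (H : continuousField R M).

Lemma tube_open (e : R[i]) xi (V : set M) :
  0 < e -> cf_sections xi -> open V -> open (@tube _ _ H e xi V).
Proof.
move=> e0 xiS oV; exists [set tube e xi V]; last by rewrite bigcup_set1.
move=> _ ->; exists (fset1 (tube e xi V)).
  by move=> _ /[!inE] ->; exists e, xi, V.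
by rewrite set_fset1 bigcap_set1.
Qed.

Lemma total_space_cvg (F : set_system (total_space H)) (h : total_space H) :
  Filter F ->
  (forall e xi V, 0 < e -> cf_sections xi -> open V -> tube e xi V h ->
     F (tube e xi V)) ->
  F --> h.
Proof.
move=> FF Ftube A; rewrite /= (@nbhsE (total_space H)).
move=> [_ [[B sB <-] [C BC Ct] sUBA]].
apply: filterS sUBA _; apply: (@filterS _ _ _ C); first by move=> ? ?; exists C.
have /sB [D sD IDeC] := BC; rewrite -IDeC; apply: filter_bigI => E DE.
have /sD := DE; rewrite inE => -[e [xi [V [e0 xiS oV EE]]]].
by rewrite /= EE; apply: Ftube => //; rewrite -EE; move: Ct; rewrite -IDeC => /(_ _ DE).
Qed.

Lemma section_continuous xi : cf_sections xi ->
  continuous (fun m => Total (xi m) : total_space H).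
Proof.
move=> xiS m; apply: total_space_cvg => e eta V e0 etaS oV [/= Vm xim].
have d0 : 0 < e - `|xi m - eta m| by rewrite subr_gt0.
have /continuousC_P/(_ _ d0) := cf_norm_continuous (cf_sectionsB xiS etaS) (x := m).
apply: filterS2 (open_nbhs_nbhs (conj oV Vm)) => n Vn; rewrite distrC => nP; split => //=.
rewrite -[ltRHS](subrK `|xi m - eta m|) -ltrBlDr.
by apply: le_lt_trans nP; apply: real_ler_norm; rewrite realB.
Qed.

End TotalSpaceTopology.

Section BisectionTopology.
Variables (M : topologicalType) (G : topGroupoid M).
Hypothesis hM : hausdorff_space M.

Lemma bis_nbhs_open (K : set M) (V : set G) : compact K -> open V ->
  open (bis_nbhs K V : set (bisection G)).
Proof.
move=> cK oV; exists [set g : {compact-open, M -> G} | g @` K `<=` V] => //.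
exact: compact_open_open.
Qed.

Lemma bis_nbhsE (s : bisection G) (W : set (bisection G)) : nbhs s W ->
  exists K V, [/\ compact K, open V, bis_nbhs K V s & bis_nbhs K V `<=` W].
Proof.
pose F := filter_from
  [set KV : set M * set G | [/\ compact KV.1, open KV.2 & bis_nbhs KV.1 KV.2 s]]
  (fun KV => bis_nbhs KV.1 KV.2).
(* Bisections are sections of [tgt], so membership in [bis_nbhs K V] only
   depends on the part of [V] above the closed set [K]. *)
have FF : Filter F.
  apply: filter_from_filter.
    exists (set0, setT); split => /=; [exact: compact0|exact: openT|by []].
  move=> [K V] [K' V'] /= [/= cK oV sV] [/= cK' oV' sV'].
  pose above (K : set M) (V : set G) := V `|` @tgt _ G @^-1` (~` K).
  have above_open L W' : compact L -> open W' -> open (above L W').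
    move=> cL oW; apply: openU => //; apply: open_comp.
      by move=> x _; exact: tgt_continuous.
    by rewrite openC; exact: compact_closed.
  have aboveP L (s' : bisection G) W' m : L m -> above L W' (s' m) -> W' (s' m).
    by move=> Lm [//|]; rewrite /= tgt_bis.
  have sub_above L (s' : bisection G) W' m : bis_nbhs L W' s' -> above L W' (s' m).
    move=> sL; have [Lm|Lm] := pselect (L m); last by right; rewrite /= tgt_bis.
    by left; apply: sL; exists m.
  exists (K `|` K', above K V `&` above K' V'); last first.
    move=> s' /= s'P; split=> _ [m Km <-].
      by have [+ _] := s'P (s' m) (ex_intro2 _ _ m (or_introl Km) erefl); exact: aboveP.
    by have [_ +] := s'P (s' m) (ex_intro2 _ _ m (or_intror Km) erefl); exact: aboveP.
  split => /=; first exact: compactU.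
    by apply: openI; exact: above_open.
  by move=> _ [m _ <-]; split; exact: sub_above.
have /(_ _)/[apply] : F --> s.
  apply: initial_cvg; apply/compact_open_cvgP => K V cK oV sV.
  by exists (K, V).
by move=> [[K V] [/= cK oV sKV] WP]; exists K, V.
Qed.

End BisectionTopology.

(** * The section space of a continuous field as a Hilbert module *)

Lemma cauchy_seq_limit (R : realType) (W : completeNormedModType R[i])
    (u : nat -> W) : cauchy_seq (@Num.norm _ W) u ->
  exists x, seq_limit (@Num.norm _ W) u x.
Proof.
move=> uc; have /cauchy_cvg/cvg_ex[x ux] : cauchy (u @ \oo).
  apply/cauchyP => e e0; have [n nP] := uc _ e0; exists (u n).
  by exists n => // i /= ni; rewrite -ball_normE /=; exact: nP.
exists x => e e0; have /cvgrPdist_lt/(_ _ e0)[n _ nP] := ux.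
by exists n => i /nP; rewrite distrC.
Qed.

Lemma C0_ext (R : realType) (M : topologicalType) (f g : C0 R M) :
  (forall m, f m = g m) -> f = g.
Proof. by move=> fg; apply: val_inj; apply/funext. Qed.

Section SectionModule.
Variables (R : realType) (M : topologicalType) (H : continuousField R M).

Record section_space :=
  SectionSpace { sec_fun :> forall m, H m; sec_mem : cf_sections sec_fun }.

HB.instance Definition _ := gen_eqMixin section_space.
HB.instance Definition _ := gen_choiceMixin section_space.

Implicit Types x y : section_space.

Lemma sec_ext x y : (forall m, x m = y m) -> x = y.
Proof.
case: x y => [x xS] [y yS] /= xy.
have {}xy : x = y by exact: functional_extensionality_dep.
case: _ / xy yS => yS.
by congr SectionSpace; exact: Prop_irrelevance.
Qed.

Definition sec_zero := SectionSpace (cf_sections0 H).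
Definition sec_opp x := SectionSpace (cf_sectionsN (sec_mem x)).
Definition sec_add x y := SectionSpace (cf_sectionsD (sec_mem x) (sec_mem y)).
Definition sec_scale (a : R[i]) x := SectionSpace (cf_sectionsZ a (sec_mem x)).

Lemma sec_addA : associative sec_add.
Proof. by move=> x y z; apply: sec_ext => m /=; rewrite addrA. Qed.

Lemma sec_addC : commutative sec_add.
Proof. by move=> x y; apply: sec_ext => m /=; rewrite addrC. Qed.

Lemma sec_add0 : left_id sec_zero sec_add.
Proof. by move=> x; apply: sec_ext => m /=; rewrite add0r. Qed.

Lemma sec_addN : left_inverse sec_zero sec_opp sec_add.
Proof. by move=> x; apply: sec_ext => m /=; rewrite addNr. Qed.

HB.instance Definition _ :=
  GRing.isZmodule.Build section_space sec_addA sec_addC sec_add0 sec_addN.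

Lemma sec_scaleA a b x : sec_scale a (sec_scale b x) = sec_scale (a * b) x.
Proof. by apply: sec_ext => m /=; rewrite scalerA. Qed.

Lemma sec_scale1 : left_id 1 sec_scale.
Proof. by move=> x; apply: sec_ext => m /=; rewrite scale1r. Qed.

Lemma sec_scaleDr : right_distributive sec_scale +%R.
Proof. by move=> a x y; apply: sec_ext => m /=; rewrite scalerDr. Qed.

Lemma sec_scaleDl x : {morph sec_scale^~ x : a b / a + b}.
Proof. by move=> a b; apply: sec_ext => m /=; rewrite scalerDl. Qed.

HB.instance Definition _ := GRing.Zmodule_isLmodule.Build R[i] section_space
  sec_scaleA sec_scale1 sec_scaleDr sec_scaleDl.

Definition sec_ip x y : C0 R M := C0_of (cf_inner_C0 (sec_mem x) (sec_mem y)).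

Definition sec_act (f : C0 R M) x := SectionSpace (cf_sections_act f (sec_mem x)).

Definition sec_norm x : R[i] := (Num.sqrt (C0_norm (sec_ip x x)))%:C.

Lemma sec_ip_ge0 x m : 0 <= sec_ip x x m.
Proof. by rewrite /= inner_norm exprn_ge0. Qed.

Lemma sqrt_sec_ip x m : sqrtC (sec_ip x x m) = `|x m|.
Proof. by rewrite /= inner_norm sqrCK. Qed.

Lemma sec_norm_ge x m : `|x m| <= sec_norm x.
Proof. by rewrite -sqrt_sec_ip C0_sqrt_norm_ge//; exact: sec_ip_ge0. Qed.

Lemma sec_norm_le x (e : R[i]) : 0 <= e -> (forall m, `|x m| <= e) ->
  sec_norm x <= e.
Proof.
move=> e0 xe; apply: C0_sqrt_norm_le => // m; first exact: sec_ip_ge0.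
by rewrite sqrt_sec_ip.
Qed.

Lemma sec_norm_ge0 x : 0 <= sec_norm x.
Proof. by rewrite lecR sqrtr_ge0. Qed.

Lemma sec_normD x y : sec_norm (x + y) <= sec_norm x + sec_norm y.
Proof.
apply: sec_norm_le => [|m]; first by rewrite addr_ge0 ?sec_norm_ge0.
by rewrite (le_trans (ler_normD _ _))// lerD ?sec_norm_ge.
Qed.

Lemma sec_normZ_le a x : sec_norm (a *: x) <= `|a| * sec_norm x.
Proof.
apply: sec_norm_le => [|m]; first by rewrite mulr_ge0 ?sec_norm_ge0.
by rewrite normrZ ler_wpM2l ?sec_norm_ge.
Qed.

Lemma sec_normZ a x : sec_norm (a *: x) = `|a| * sec_norm x.
Proof.
apply/eqP; rewrite eq_le sec_normZ_le /=.
have [->|a0] := eqVneq a 0; first by rewrite normr0 mul0r sec_norm_ge0.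
rewrite -ler_pdivlMl ?normr_gt0// -normfV.
by apply: le_trans (sec_normZ_le _ _); rewrite scalerA mulVf// scale1r.
Qed.

Lemma sec_norm_eq0 x : sec_norm x = 0 -> x = 0.
Proof.
move=> x0; apply: sec_ext => m; apply/eqP; rewrite -normr_le0 -x0.
exact: sec_norm_ge.
Qed.

(** The pointwise limit is a uniform one. Its norm is then in C_0(M) by [is_C0_limit], and the terms
    of the sequence are the local approximations asked for by [cf_local]. *)
Lemma sec_complete u : cauchy_seq sec_norm u -> exists x, seq_limit sec_norm u x.
Proof.
move=> uc.
have lims : forall m, exists h : H m, seq_limit (@Num.norm _ (H m)) (fun i => u i m) h.
  move=> m; apply: cauchy_seq_limit => e /uc[n nP]; exists n => i j ni nj.
  exact: le_lt_trans (sec_norm_ge (u i - u j) m) (nP i j ni nj).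
pose xi m := sval (cid (lims m)); have xiP m := svalP (cid (lims m)).
have unif e : 0 < e -> exists n, forall i, (n <= i)%N -> forall m, `|u i m - xi m| < e.
  move=> e0; have [n nP] := uc _ (divr_gt0 e0 (ltr0Sn R[i] 1)); exists n => i ni m.
  (* The index k depends on m, but it only serves as an intermediate term: the bound n is the same
     for all m. *)
  have [k kP] := xiP m _ (divr_gt0 e0 (ltr0Sn R[i] 1)).
  rewrite -(subrK (u (maxn n k) m) (u i m)) -addrA [ltRHS]splitr.
  apply: le_lt_trans (ler_normD _ _) _; rewrite ltrD ?kP ?leq_maxr//.
  apply: le_lt_trans (sec_norm_ge (u i - u (maxn n k)) m) _.
  by rewrite nP ?leq_maxl.
have xiS : cf_sections xi.
  apply: cf_local => [|e m /unif[n /(_ n (leqnn n)) nP]].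
    apply: is_C0_limit => e /unif[n /(_ n (leqnn n)) nP].
    exists (fun m => `|u n m|); first exact: cf_norm_C0 (sec_mem _).
    move=> m; apply: le_lt_trans (nP m); rewrite distrC.
    exact: ler_dist_dist.
  exists (u n); first exact: sec_mem.
  by apply: nearW => k; rewrite distrC.
exists (SectionSpace xiS) => e e0.
have e2 : 0 < e / 2 by rewrite divr_gt0.
have [n nP] := unif _ e2; exists n => i ni.
apply: (@le_lt_trans _ _ (e / 2)); last by rewrite gtr_pMr// invf_lt1// ltr1n.
by apply: sec_norm_le (ltW e2) _ => m; rewrite ltW//; exact: nP.
Qed.

Definition sec_complete_norm : complete_norm section_space :=
  CompleteNorm sec_normD sec_normZ sec_norm_eq0 sec_complete.

Definition section_module : hilbertModule R M.
Proof.
refine (@HilbertModule R M (normed_copy sec_complete_norm) sec_act sec_ip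
  _ _ _ _ _ _ _ _ (fun=> erefl)).
- by move=> f a x y; apply: sec_ext => m /=; rewrite scalerDr !scalerA mulrC.
- by move=> x a f g; apply: sec_ext => m /=; rewrite scalerDl scalerA.
- by move=> f g x; apply: sec_ext => m /=; rewrite scalerA.
- move=> x a y z; apply: C0_ext => m /=.
  by rewrite (si_linear (inner_semi_inner _)).
- move=> f x y; apply: C0_ext => m /=.
  by rewrite (siZr (inner_semi_inner _)).
- by move=> x y m /=; rewrite -(si_hermitian (inner_semi_inner _)).
- exact: sec_ip_ge0.
- move=> x x0; apply: sec_ext => m; apply/eqP.
  rewrite -normr_eq0 -sqrf_eq0 -inner_norm.
  by rewrite -[inner _ _]/(sec_ip x x m) x0.
Defined.

End SectionModule.

(** * The representation of Bis(G) induced by a representation of G *)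

Section Along.
Variables (R : realType) (M : topologicalType) (G : topGroupoid M).

Lemma along_unitary (H : M -> hilbertSpace R)
    (op : forall g : G, H (src g) -> H (tgt g)) (g : G) m n
    (e : src g = m) (e' : tgt g = n) :
  unitary_op (op g) -> unitary_op (along op e e').
Proof. by case: _ / e; case: _ / e'. Qed.

(** The base points m and m' agree only propositionally, so vectors over them cannot be compared
    directly; taking both as values of one section [xi] avoids a further transport. *)
Lemma along_irrelevance (H : M -> hilbertSpace R)
    (op : forall g : G, H (src g) -> H (tgt g)) (xi : forall m, H m)
    (g g' : G) m m' n (e : src g = m) (e' : tgt g = n)
    (f : src g' = m') (f' : tgt g' = n) :
  g = g' -> along op e e' (xi m) = along op f f' (xi m').
Proof.
move=> gg'; case: _ / gg' f f' => f f'.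
case: _ / e; case: _ / f; case: _ / e' f' => f'.
by rewrite (Prop_irrelevance f' erefl).
Qed.

Variable p : unitaryRep R G.
Let op := @ur_op _ _ _ p.

(** In the total space the transports vanish, so that continuity can be discussed without them. *)
Lemma along_total (xi : forall m, p m) (g : G) m n (e : src g = m) (e' : tgt g = n) :
  Total (along op e e' (xi m)) = Total (op (xi (src g))).
Proof. by case: _ / e; case: _ / e'. Qed.

Lemma along_unt k m (e : src (unt G k) = m) (e' : tgt (unt G k) = m) (h : p m) :
  along op e e' h = h.
Proof.
have km : k = m by rewrite -(src_unt G k).
case: _ / km h e e' => h e e'.
by rewrite (Prop_irrelevance e (src_unt G k)) (Prop_irrelevance e' (tgt_unt G k)) ur_unt.
Qed.

Lemma along_mul (g g' : G) k n m (e : src g' = k) (e' : tgt g' = n)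
    (f : src g = n) (f' : tgt g = m) (a : src (mul g g') = k)
    (b : tgt (mul g g') = m) (h : p k) :
  along op a b h = along op f f' (along op e e' h).
Proof.
case: _ / e a h => a h; case: _ / e' f => f; case: _ / f' b => b.
by rewrite (Prop_irrelevance a (src_mul f)) (Prop_irrelevance b (tgt_mul f)) ur_mul.
Qed.

Lemma along_linear (g : G) m n (e : src g = m) (e' : tgt g = n) :
  linear (along op e e').
Proof. by have [] := along_unitary e e' (ur_unitary p g). Qed.

Lemma along_scale (g : G) m n (e : src g = m) (e' : tgt g = n) a x :
  along op e e' (a *: x) = a *: along op e e' x.
Proof.
have l := along_linear e e'; have := l a x 0; have := l (-1) 0 0.
by rewrite !scaler0 !addr0 => ->; rewrite scaleN1r addNr addr0.
Qed.

Lemma along_inner (g : G) m n (e : src g = m) (e' : tgt g = n) x y :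
  inner (along op e e' x) (along op e e' y) = inner x y.
Proof. by have [_ ->] := along_unitary e e' (ur_unitary p g). Qed.

Lemma along_norm (g : G) m n (e : src g = m) (e' : tgt g = n) x :
  `|along op e e' x| = `|x|.
Proof. by rewrite !norm_seminorm /seminorm along_inner. Qed.

End Along.

Section InducedRepresentation.
Variables (R : realType) (M : topologicalType) (G : topGroupoid M).
Hypothesis lcM : locally_compact [set: M].
Hypothesis inverse_continuous : continuous (fun s : bisection G => s^-1%g).
Variable p : unitaryRep R G.

Let op := @ur_op _ _ _ p.
Let D := section_module p.

Lemma rep_section_continuous (xi : forall m, p m) : cf_sections xi ->
  continuous (fun g : G => Total (op (xi (src g))) : total_space p).
Proof.
move=> xiS.
have fc : continuous (fun g => Fibred (xi (src g)) : fibred_product G p).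
  apply: continuous_comp_initial => g.
  pose tot (g' : G) : total_space p := Total (xi (src g')).
  apply: (@cvg_pair _ _ _ (nbhs g) (nbhs g) (nbhs (tot g)) _ _ _ id tot).
    exact: cvg_id.
  exact: (continuous_comp (@src_continuous _ G g) (section_continuous xiS (x := src g))).
by move=> g; exact: (continuous_comp (fc g) (@ur_continuous _ _ _ p _)).
Qed.

Definition act_fun (s : bisection G) (xi : forall m, p m) (m : M) : p m :=
  along op erefl (tgt_bis s m) (xi (src (s m))).

Lemma act_total s xi m : Total (act_fun s xi m) = Total (op (xi (src (s m)))).
Proof. exact: (along_total xi erefl (tgt_bis s m)). Qed.

Lemma tube_total (e : R[i]) eta (V : set M) m (h : p m) :
  tube e eta V (Total h) = (V m /\ `|h - eta m| < e).
Proof. by []. Qed.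

(** The norm of the image is the pullback of that of [xi], hence in C_0(M). Near m, take a section
    [eta] through the value at m: the tube around [eta] is open, and by continuity of the groupoid
    representation the image stays in it. *)
Lemma act_fun_sections s xi : cf_sections xi -> cf_sections (act_fun s xi).
Proof.
move=> xiS; apply: cf_local => [|e m e0].
  have -> : (fun m => `|act_fun s xi m|) =
      (fun m => `|xi m| : R[i]) \o (fun m => src (s m)).
    by apply/funext => m; rewrite /= along_norm.
  exact: is_C0_pullback (bis_homeo s) (cf_norm_C0 xiS).
have [eta etaS etam] := cf_total (act_fun s xi m).
exists eta => //.
have : continuous (fun m => Total (op (xi (src (s m)))) : total_space p).
  move=> n; apply: (@continuous_comp _ _ _ s
    (fun g : G => Total (op (xi (src g))) : total_space p)).
    exact: bis_continuous.
  exact: (rep_section_continuous xiS).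
move=> /(_ m (tube e eta setT)) Tc.
have /Tc : nbhs (Total (op (xi (src (s m)))) : total_space p) (tube e eta setT).
  apply: open_nbhs_nbhs; split; first by apply: tube_open => //; exact: openT.
  by rewrite -act_total tube_total etam subrr normr0.
move=> TA; apply: (@filterS _ (nbhs m) _ _ _ _ TA) => n.
by rewrite /= -act_total tube_total => -[].
Qed.

Lemma act_norm s xi m : `|act_fun s xi m| = `|xi (src (s m))|.
Proof. exact: along_norm. Qed.

Definition act_sec (s : bisection G) (x : D) : D :=
  SectionSpace (act_fun_sections s (sec_mem (x : section_space p))).

Lemma act_sec_linear s : linear (act_sec s).
Proof.
by move=> a x y; apply: sec_ext => m; rewrite /= /act_fun along_linear.
Qed.

Lemma act_sec_norm_le s x : `|act_sec s x| <= `|x|.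
Proof.
apply: (sec_norm_le (sec_norm_ge0 x)) => m.
by rewrite act_norm; exact: sec_norm_ge.
Qed.

Lemma act_sec_one x : act_sec 1%g x = x.
Proof.
apply: sec_ext => m; rewrite -[RHS](along_unt (src_unt G m) (tgt_unt G m)).
exact: along_irrelevance.
Qed.

Lemma act_sec_mul s s' x : act_sec (s * s')%g x = act_sec s (act_sec s' x).
Proof.
apply: sec_ext => m; rewrite /= /act_fun.
have c : src (s m) = tgt (s' (src (s m))) by rewrite tgt_bis.
have b : tgt (mul (s m) (s' (src (s m)))) = m by rewrite tgt_mul// tgt_bis.
rewrite -(along_mul _ _ _ _ (src_mul c) b).
exact: along_irrelevance.
Qed.

Lemma act_sec_unitary s x y :
  sec_ip (act_sec s x) (act_sec s y) = C0_pullback (bis_homeo s) (sec_ip x y).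
Proof. by apply: C0_ext => m; exact: along_inner. Qed.

Lemma act_sec_C0_linear s (f : C0 R M) x :
  act_sec s (sec_act f x) = sec_act (C0_pullback (bis_homeo s) f) (act_sec s x).
Proof.
apply: sec_ext => m; rewrite /= /act_fun.
exact: along_scale.
Qed.

Lemma act_sec_local (s : bisection G) m (x : D) : s m = unt G m ->
  hm_norm_at (act_sec s x - x) m = 0.
Proof.
move=> sm; rewrite /hm_norm_at sqrt_sec_ip /= /act_fun.
rewrite (along_irrelevance op _ erefl (tgt_bis s m) (src_unt G m) (tgt_unt G m) sm).
by rewrite ur_unt subrr normr0.
Qed.

Lemma act_sec_near (x : D) (s0 : bisection G) (e : R[i]) : 0 < e ->
  \forall s \near s0, forall m,
    `|act_fun s0 (sec_fun x) m - act_fun s (sec_fun x) m| < e.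
Proof.
move=> e0; have e2 : 0 < e / 2 by rewrite divr_gt0.
have [_ /(_ _ e2)[K cK xK]] := cf_norm_C0 (sec_mem x).
have [bK bK' _ bc'] := bis_base_invP s0.
have [L cL KL] : exists2 L, compact L & bis_base_inv s0 @` K `<=` L°.
  apply: compact_interior_cover => //; apply: continuous_compact => //.
  exact: continuous_subspaceT.
(* The base map of [s^-1] is the inverse of that of s, so this says that the preimage of K under the
   base map of s lies in the interior of L. *)
have near_inv : \forall s \near s0, bis_nbhs K (src (t := G) @^-1` L°) s^-1%g.
  apply: inverse_continuous; apply: open_nbhs_nbhs; split.
    apply: bis_nbhs_open => //; apply: open_comp; last exact: open_interior.
    by move=> g _; exact: src_continuous.
  move=> _ [k Kk <-] /=; rewrite src_inv tgt_bis; apply: KL.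
  by exists k.
(* The arrows that send [x] into the tube around the image of [x] under [s0]. For the arrow [s m]
   this is exactly the estimate wanted at m, so on L the claim is a single subbasic condition of the
   compact-open topology. *)
pose V := (fun g : G => Total (op (sec_fun x (src g)))) @^-1`
  tube e (act_fun s0 (sec_fun x)) setT.
have oV : open V.
  apply: open_comp; last first.
    apply: tube_open => //; last exact: openT.
    exact/act_fun_sections/sec_mem.
  by move=> g _; exact/rep_section_continuous/sec_mem.
have VP (s : bisection G) m : V (s m) <->
    `|act_fun s0 (sec_fun x) m - act_fun s (sec_fun x) m| < e.
  by rewrite /V /= -act_total tube_total distrC; split=> [[]|].
have near_L : \forall s \near s0, bis_nbhs L V s.
  apply: open_nbhs_nbhs; split; first exact: bis_nbhs_open.
  by move=> _ [m _ <-]; apply/VP; rewrite subrr normr0.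
apply: filterS2 (near_inv) near_L => s sK sL m.
have [Lm|nLm] := pselect (L m); first by apply/VP/sL; exists m.
(* For m outside L, the point [src (s' m)] is not in K, since the inverse base map would bring it
   back to m inside L; so [x] is small there. This is applied to both s and [s0]. *)
have off (s' : bisection G) : bis_nbhs K (src (t := G) @^-1` L°) s'^-1%g ->
    `|act_fun s' (sec_fun x) m| < e / 2.
  move=> s'K; rewrite act_norm -[X in X < _]normr_id; apply: xK => Ks'm.
  have := s'K _ (ex_intro2 _ _ _ Ks'm erefl).
  have [cK' _ _ _] := bis_base_invP s'.
  by rewrite /= src_inv tgt_bis cK' => /interior_subset.
rewrite [ltRHS]splitr (le_lt_trans (ler_normB _ _))// ltrD// off//.
exact: nbhs_singleton near_inv.
Qed.

Lemma act_sec_continuous :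
  continuous (fun x : bisection G * D => act_sec x.1 x.2).
Proof.
move=> [s0 x0]; apply/cvgrPdist_lt => e e0 /=.
have e2 : 0 < e / 2 by rewrite divr_gt0.
(* Strict pointwise bounds give only a weak bound on the norm; a quarter of e leaves room for
   strictness. Joint continuity then follows since each operator is contractive in x. *)
have e4 : 0 < e / 2 / 2 by rewrite divr_gt0.
have near_s := act_sec_near x0 s0 e4.
have near_x : \forall x \near x0, `|x0 - x| < e / 2.
  by have /cvgrPdist_lt/(_ _ e2) : x @[x --> x0] --> x0 by exact: cvg_id.
exists ([set s | forall m,
    `|act_fun s0 (sec_fun x0) m - act_fun s (sec_fun x0) m| < e / 2 / 2],
  [set x | `|x0 - x| < e / 2]); first by split.
move=> z [/= z1 z2].
rewrite -(subrK (act_sec z.1 x0) (act_sec s0 x0)) -addrA [ltRHS]splitr.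
apply: le_lt_trans (ler_normD _ _) _; rewrite ltrD//.
  apply: (@le_lt_trans _ _ (e / 2 / 2)); last by rewrite gtr_pMr// invf_lt1// ltr1n.
  by apply: sec_norm_le (ltW e4) _ => m; rewrite ltW//; exact: z1.
apply: le_lt_trans z2; rewrite (_ : _ - _ = act_sec z.1 (x0 - z.2)).
  exact: act_sec_norm_le.
have := act_sec_linear z.1 (-1) z.2 x0; rewrite !scaleN1r [- z.2 + _]addrC => ->.
by rewrite addrC.
Qed.

Definition induced_rep : bisectionRep R G :=
  @BisectionRep R M G D act_sec act_sec_linear act_sec_one act_sec_mul
    act_sec_continuous act_sec_unitary act_sec_C0_linear act_sec_local.

Lemma induced_repP : induced_by p induced_rep.
Proof.
exists (fun x : D => sec_fun x) => //; split => //.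
apply/seteqP; split=> [_ [x _ <-]|xi xiS]; first exact: sec_mem.
by exists (SectionSpace xiS).
Qed.

End InducedRepresentation.

Lemma inj_surj_bijective (A B : Type) (f : A -> B) :
  injective f -> (forall b, exists a, f a = b) -> bijective f.
Proof.
move=> finj /choice[g gP]; exists g => // a; exact: finj.
Qed.

(** * Isomorphisms *)

Section UnitaryOp.
Variables (R : realType) (H K : hilbertSpace R) (U : H -> K).
Hypothesis UP : unitary_op U.

Lemma unitary_inj : injective U.
Proof.
have [Ul Ui _] := UP; move=> x y Uxy; apply/eqP; rewrite -subr_eq0.
rewrite -normr_eq0 -sqrf_eq0 -inner_norm -Ui [x - y]addrC -scaleN1r Ul Uxy.
by rewrite scaleN1r addNr (si0r (inner_semi_inner K)).
Qed.

Lemma unitary_scale a x : U (a *: x) = a *: U x.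
Proof.
have [Ul _ _] := UP; have := Ul a x 0; have := Ul (-1) 0 0.
by rewrite !scaler0 !addr0 => ->; rewrite scaleN1r addNr addr0.
Qed.

End UnitaryOp.

Section SectionModuleIso.
Variables (R : realType) (M : topologicalType).
Variables (D : hilbertModule R M) (H : continuousField R M).
Variable Phi : D -> forall m, H m.
Hypothesis PhiP : section_module_iso Phi.

Lemma smi_eq x y m : Phi x m = Phi y m <-> hm_ip (x - y) (x - y) m = 0.
Proof.
have [lin _ ip _] := PhiP.
have -> : hm_ip (x - y) (x - y) m = `|Phi x m - Phi y m| ^+ 2.
  by rewrite ip inner_norm [x - y]addrC -scaleN1r lin scaleN1r addrC.
split=> [->|/eqP]; first by rewrite subrr normr0 expr0n.
by rewrite sqrf_eq0 normr_eq0 subr_eq0 => /eqP.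
Qed.

Lemma smi_inj x y : (forall m, Phi x m = Phi y m) -> x = y.
Proof.
move=> xy; apply/eqP; rewrite -subr_eq0; apply/eqP/hm_ip_definite.
by apply: C0_ext => m; apply/smi_eq.
Qed.

Lemma smi_section x : cf_sections (Phi x).
Proof. by have [_ _ _ <-] := PhiP; exists x. Qed.

Lemma smi_lift xi : cf_sections xi -> exists x, forall m, Phi x m = xi m.
Proof. by have [_ _ _ <-] := PhiP => -[x _ <-]; exists x. Qed.

Lemma smi_total m (h : H m) : exists x, Phi x m = h.
Proof.
have [xi /smi_lift[x xE] <-] := cf_total h.
by exists x; exact: xE.
Qed.

End SectionModuleIso.

Section Isomorphisms.
Variables (R : realType) (M : topologicalType) (G : topGroupoid M).

Lemma along_intertwine (p p' : unitaryRep R G) (U : forall m, p m -> p' m)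
    (g : G) m n (e : src g = m) (e' : tgt g = n) (h : p m) :
  (forall h : p (src g), U (tgt g) (ur_op h) = ur_op (U (src g) h)) ->
  U n (along (@ur_op _ _ _ p) e e' h) = along (@ur_op _ _ _ p') e e' (U m h).
Proof. by move=> UE; case: _ / e h => h; case: _ / e'; exact: UE. Qed.

Variables (p p' : unitaryRep R G) (t t' : bisectionRep R G).
Hypothesis bis_total : forall g : G, exists (s : bisection G) m, s m = g.

(** [Psi] is composition of sections with the fibrewise operators [U]. Each property is checked
    fibre by fibre, as [Phi'] is injective on sections. *)
Lemma unitaryRep_iso_bisectionRep : induced_by p t -> induced_by p' t' ->
  unitaryRep_iso p p' -> bisectionRep_iso t t'.
Proof.
move=> [Phi PhiP PhiE] [Phi' PhiP' PhiE'] [U [Uu US UE]].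
have /choice[Psi PsiE] : forall x, exists y, forall m, Phi' y m = U m (Phi x m).
  by move=> x; apply: (smi_lift PhiP'); apply/US; exact: (smi_section PhiP).
have [lin act ip _] := PhiP; have [lin' act' ip' _] := PhiP'.
exists Psi; split; first split.
- move=> a x y; apply: (smi_inj PhiP') => m; rewrite lin' !PsiE lin.
  by have [-> _ _] := Uu m.
- apply: inj_surj_bijective => [x y xy|y].
    apply: (smi_inj PhiP) => m; apply: (unitary_inj (Uu m)).
    by rewrite -!PsiE xy.
  have xiE m : {h : p m | U m h = Phi' y m}.
    by have [_ _ sur] := Uu m; exact: cid (sur _).
  have [|x xE] := smi_lift PhiP (xi := fun m => sval (xiE m)).
    apply/US; rewrite (_ : (fun m => _) = Phi' y); first exact: (smi_section PhiP').
    by apply: functional_extensionality_dep => m; exact: (svalP (xiE m)).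
  exists x; apply: (smi_inj PhiP') => m.
  by rewrite PsiE xE; exact: (svalP (xiE m)).
- move=> f x; apply: (smi_inj PhiP') => m.
  by rewrite PsiE act act' PsiE (unitary_scale (Uu m)).
- move=> x y; apply: C0_ext => m; rewrite ip' !PsiE.
  by have [_ -> _] := Uu m; rewrite ip.
- move=> s x; apply: (smi_inj PhiP') => m.
  by rewrite PsiE PhiE PhiE' PsiE along_intertwine.
Qed.

(** The operator at m sends the value of x to the value of [Psi x]. It is well defined because [Psi]
    preserves the function <x, x>, hence the vectors that vanish at m. *)
Lemma bisectionRep_iso_unitaryRep : induced_by p t -> induced_by p' t' ->
  bisectionRep_iso t t' -> unitaryRep_iso p p'.
Proof.
move=> [Phi PhiP PhiE] [Phi' PhiP' PhiE'] [Psi [[Plin Pbij] Pact Pip PE]].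
have [lin act ip _] := PhiP; have [lin' act' ip' _] := PhiP'.
have PB x y : Psi (x - y) = Psi x - Psi y.
  by rewrite [x - y]addrC -scaleN1r Plin scaleN1r addrC.
pose pre m (h : p m) := sval (cid (smi_total PhiP h)).
have preP m (h : p m) : Phi (pre m h) m = h := svalP (cid (smi_total PhiP h)).
pose U m (h : p m) := Phi' (Psi (pre m h)) m.
have UE m x : U m (Phi x m) = Phi' (Psi x) m.
  by apply/(smi_eq PhiP'); rewrite -PB Pip; apply/(smi_eq PhiP).
have Uu m : unitary_op (U m).
  split=> [a h k|h k|h].
  - by rewrite -(preP m h) -(preP m k) -lin !UE Plin lin'.
  - by rewrite -(preP m h) -(preP m k) !UE -ip' Pip ip.
  - have [y <-] := smi_total PhiP' h; have [Psi' _ PK] := Pbij.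
    by exists (Phi (Psi' y) m); rewrite UE PK.
exists U; split => //.
- move=> xi; split=> [/(smi_lift PhiP)[x xE]|/(smi_lift PhiP')[y yE]].
    rewrite (_ : (fun m => _) = Phi' (Psi x)); first exact: (smi_section PhiP').
    by apply: functional_extensionality_dep => m; rewrite -xE UE.
  have [Psi' _ PK] := Pbij.
  rewrite (_ : xi = Phi (Psi' y)); first exact: (smi_section PhiP).
  apply: functional_extensionality_dep => m; apply: (unitary_inj (Uu m)).
  by rewrite UE PK -yE.
(* With n and e generalised, g can be replaced by [s n]; then both sides are values of the operators
   of s on the two modules. *)
have key (g : G) n (e : tgt g = n) (h : p (src g)) : (exists s : bisection G, s n = g) ->
    U n (along (@ur_op _ _ _ p) erefl e h) =
    along (@ur_op _ _ _ p') erefl e (U (src g) h).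
  move=> [s sn]; case: _ / sn e h => e h.
  rewrite (Prop_irrelevance e (tgt_bis s n)).
  by have [x <-] := smi_total PhiP h; rewrite -PhiE !UE PE PhiE'.
move=> g h; have [s [m sm]] := bis_total g.
have gm : tgt g = m by rewrite -sm tgt_bis.
have := key g m gm h (ex_intro _ s sm).
by case: _ / gm {sm}.
Qed.

End Isomorphisms.

(** * The continuous field of a Hilbert module *)

Lemma is_C0_mul_bounded (R : realType) (M : topologicalType)
    (f g : M -> R[i]) (c : R[i]) : is_C0 f -> continuous g ->
  (forall m, `|g m| <= c) -> is_C0 (fun m => f m * g m).
Proof.
move=> [fc f0] gc gb; split=> [m|e e0]; first exact: cvgM (fc m) (gc m).
have c1 : 0 < `|c| + 1 by rewrite ltr_wpDl.
have [K cK fK] := f0 _ (divr_gt0 e0 c1); exists K => // m /fK.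
rewrite ltr_pdivlMr// normrM; apply: le_lt_trans; rewrite ler_wpM2l//.
apply: le_trans (gb m) _; rewrite -[leLHS]addr0 lerD//.
by rewrite ger0_norm//; exact: le_trans (gb m).
Qed.

(* With [b = <x, x>] and [a = <x, x>(m)], the function [b * (2 a / (b^2 + a^2))] is
   1 at [m], and multiplying [x] by it brings the norm of [x] down to at most
   [2 |x|(m)]: it replaces a cut-off function around [m]. *)
Lemma lift_weight_le (R : realType) (a b : R[i]) : 0 < a -> 0 <= b ->
  (b * (2 * a / (b ^+ 2 + a ^+ 2))) ^+ 2 * b <= 2 ^+ 2 * a.
Proof.
move=> /gt0_real_complex[r r0 ->] /ge0_real_complex[s s0 ->].
have d0 : 0 < s ^+ 2 + r ^+ 2 by rewrite ltr_wpDl ?exprn_ge0 ?exprn_gt0.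
have -> : (s%:C * (2 * r%:C / (s%:C ^+ 2 + r%:C ^+ 2))) ^+ 2 * s%:C =
    ((s * (2 * r / (s ^+ 2 + r ^+ 2))) ^+ 2 * s)%:C.
  by rewrite !(rmorphM, rmorphXn, rmorphD, fmorphV, rmorph_nat).
have -> : 2 ^+ 2 * r%:C = (2 ^+ 2 * r)%:C by rewrite !(rmorphM, rmorphXn, rmorph_nat).
rewrite lecR.
have -> : (s * (2 * r / (s ^+ 2 + r ^+ 2))) ^+ 2 * s =
    (2 ^+ 2 * r ^+ 2 * s ^+ 3) / (s ^+ 2 + r ^+ 2) ^+ 2 by field; rewrite gt_eqF.
rewrite ler_pdivrMr ?exprn_gt0//.
have -> : 2 ^+ 2 * r ^+ 2 * s ^+ 3 = 2 ^+ 2 * r * (r * s * s ^+ 2) by ring.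
rewrite ler_wpM2l ?mulr_ge0 ?(ltW r0)// expr2 ler_pM ?mulr_ge0 ?(ltW r0) ?exprn_ge0//.
  by nra.
by rewrite lerDl exprn_ge0// ltW.
Qed.

(** * Completeness of a Hilbert module for the seminorm at a point *)

Section PointwiseNorm.
Variables (R : realType) (M : topologicalType) (D : hilbertModule R M).
Implicit Types (x y : D) (m : M).

Lemma hm_ip_actr f x y m : hm_ip x (hm_act f y) m = f m * hm_ip x y m.
Proof. by rewrite hm_ip_act. Qed.

Lemma hm_ip_actl f x y m : hm_ip (hm_act f x) y m = (f m)^* * hm_ip x y m.
Proof. by rewrite hm_ip_hermitian hm_ip_actr rmorphM/= -hm_ip_hermitian. Qed.

(** The fibre at m sees a function only through its value there: in the expansion of the square norm
    all four terms are |f m|^2 <x, x>(m) up to sign, and they cancel. *)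
Lemma hm_norm_at_act_sub f x m : hm_norm_at (hm_act f x - f m *: x) m = 0.
Proof.
have qP := hm_ip_semi_inner D m.
have nn : - f m *: x = - (f m *: x) by rewrite scaleNr.
rewrite /hm_norm_at -nn (siD2 qP) (siZl qP) !(siZr qP) !hm_ip_actl !hm_ip_actr.
rewrite !(rmorphM, rmorphN)/= conjCK -[(hm_ip x x m)^*]hm_ip_hermitian.
by rewrite (_ : _ + _ = 0) ?sqrtC0//; ring.
Qed.

(** The lift is [x] multiplied by the weight of [lift_weight_le]. That weight is 1 at m, so the
    class there is unchanged, and it is in C_0(M) as <x, x> times a continuous function bounded by 2
    / a. The norm bound turns rapidly converging sequences in the fibre into convergent series in
    D. *)
Lemma hm_norm_at_lift x m :
  exists2 y, hm_norm_at (x - y) m = 0 & `|y| <= 2 * hm_norm_at x m.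
Proof.
have qP := hm_ip_semi_inner D m.
have [x0|x0] := eqVneq (hm_ip x x m) 0.
  by exists 0; rewrite ?subr0 ?normr0 /hm_norm_at x0 sqrtC0 ?mulr0.
have a0 : 0 < hm_ip x x m by rewrite lt_neqAle eq_sym x0 hm_ip_ge0.
set a := hm_ip x x m in a0.
have [ac _] := C0P (hm_ip x x).
have den n : 0 < hm_ip x x n ^+ 2 + a ^+ 2.
  by rewrite ltr_wpDl ?exprn_ge0 ?exprn_gt0 ?hm_ip_ge0.
have fC : is_C0 (fun n => hm_ip x x n * (2 * a / (hm_ip x x n ^+ 2 + a ^+ 2))).
  apply: (@is_C0_mul_bounded _ _ _ _ (2 / a)); first exact: C0P.
    move=> n; apply: cvgM; first exact: cvg_cst.
    apply: cvgV; first by rewrite gt_eqF.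
    by apply: cvgD; [apply: cvgM; exact: ac|exact: cvg_cst].
  move=> n; rewrite ger0_norm ?divr_ge0 ?mulr_ge0 ?(ltW (den n))//; last exact: ltW.
  rewrite ler_pdivrMr// mulrDr; apply: (@le_trans _ _ (2 / a * a ^+ 2)).
    by rewrite expr2 !mulrA divfK ?gt_eqF.
  by rewrite lerDr mulr_ge0 ?divr_ge0 ?exprn_ge0 ?hm_ip_ge0//; exact: ltW.
pose f := C0_of fC.
have fm : f m = 1.
  rewrite /f /= -/a mulrA (_ : a ^+ 2 + a ^+ 2 = a * (2 * a)); last by ring.
  by rewrite divff// !mulf_neq0 ?gt_eqF.
exists (hm_act f x).
  have := hm_norm_at_act_sub f x m; rewrite fm scale1r.
  by rewrite hm_norm_atB.
apply: hm_norm_le => [|n]; first by rewrite mulr_ge0 ?hm_norm_at_ge0.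
rewrite -(@ler_pXn2r _ 2)// ?nnegrE ?mulr_ge0 ?hm_norm_at_ge0//.
rewrite hm_norm_at_act !exprMn !hm_norm_atK -/a.
have f0 : 0 <= f n.
  by rewrite /f /= mulr_ge0 ?divr_ge0 ?mulr_ge0 ?hm_ip_ge0 ?(ltW (den n))//; exact: ltW.
by rewrite ger0_norm// lift_weight_le// hm_ip_ge0.
Qed.

Lemma hm_norm_at_complete m (u : nat -> D) :
  cauchy_seq (fun x => hm_norm_at x m) u ->
  exists x, seq_limit (fun x => hm_norm_at x m) u x.
Proof.
move=> uc; have h0 k : 0 < 2^-1 ^+ k :> R[i] by rewrite exprn_gt0// invr_gt0.
have [n nP] := choice (fun k => uc _ (h0 k)).
(* The sum of [n 0], ..., [n k] dominates each of these indices, so both terms of an increment of v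
   lie in the range controlled by [n k] without making n monotone. *)
pose v k := u (\sum_(i < k.+1) n i)%N.
have le_n k l : (k <= l)%N -> (n k <= \sum_(i < l.+1) n i)%N.
  by move=> kl; rewrite (bigD1 (Ordinal (kl : (k < l.+1)%N)))//= leq_addr.
have [d d1 d2] : exists2 d : nat -> D,
    (forall k, hm_norm_at (v k.+1 - v k - d k) m = 0) &
    (forall k, `|d k| <= 2 * 2^-1 ^+ k).
  have /choice[d dP] k : exists y, hm_norm_at (v k.+1 - v k - y) m = 0 /\
      `|y| <= 2 * 2^-1 ^+ k.
    have [y y1 y2] := hm_norm_at_lift (v k.+1 - v k) m; exists y; split => //.
    by rewrite (le_trans y2)// ler_wpM2l// ltW// nP ?le_n.
  by exists d => k; have [] := dP k.
(* The partial sums of lifts of the increments of [v] represent [v] in the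
   fibre at [m] and converge in norm. *)
pose S k := v 0 + \sum_(i < k) d i.
have Sv k : hm_norm_at (S k - v k) m = 0.
  elim: k => [|k IH]; first by rewrite /S big_ord0 addr0 subrr hm_norm_at0.
  apply/eqP; rewrite eq_le hm_norm_at_ge0 andbT.
  rewrite /S big_ord_recr /= addrA -/(S k).
  have -> : S k + d k - v k.+1 = (S k - v k) - (v k.+1 - v k - d k).
    by rewrite !opprB addrACA addKr.
  have := hm_norm_atD (S k - v k) (- (v k.+1 - v k - d k)) m.
  by rewrite hm_norm_atN IH d1 addr0.
(* The constant 4 is that of the geometric tail of the terms 2 * 2^-i; the induction is run on the
   exact partial sum. *)
have Sd k j : `|S (k + j)%N - S k| <= 2 ^+ 2 * 2^-1 ^+ k.
  have : `|S (k + j)%N - S k| <= 2 ^+ 2 * (2^-1 ^+ k - 2^-1 ^+ (k + j)).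
    elim: j => [|j IH]; first by rewrite addn0 !subrr normr0 mulr0.
    rewrite addnS /S big_ord_recr /= addrA -/(S (k + j)%N) addrAC.
    rewrite (le_trans (ler_normD _ _))// (le_trans (lerD IH (d2 _)))//.
    by rewrite (exprS _ (k + j)%N) le_eqVlt; apply/orP; left; apply/eqP; field.
  move=> /le_trans; apply; rewrite ler_wpM2l ?exprn_ge0//.
  by rewrite lerBlDr lerDl ltW.
have half_lt (e : R[i]) : 0 < e -> exists k, forall l, (k <= l)%N -> 2^-1 ^+ l < e.
  move=> /exists_inv_lt[k kP]; exists k => l /kP; apply: le_lt_trans.
  rewrite exprVn lef_pV2 ?posrE ?exprn_gt0 ?ltr0Sn//.
  by rewrite -natrX ler_nat ltn_expl.
have four (e : R[i]) : 0 < e -> 0 < e / 2 ^+ 2 by move=> e0; rewrite divr_gt0 ?exprn_gt0.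
have [e e0|x xP] := @cauchy_seq_limit R D S.
  have [k kP] := half_lt _ (four _ (divr_gt0 e0 (ltr0Sn R[i] 1))).
  exists k => i j ki kj; rewrite -(subrK (S k) (S i)) -addrA [ltRHS]splitr.
  have SE l : (k <= l)%N -> `|S l - S k| < e / 2.
    move=> kl; rewrite -(subnKC kl) (le_lt_trans (Sd _ _))//.
    by rewrite mulrC -ltr_pdivlMr ?exprn_gt0// kP.
  by rewrite (le_lt_trans (ler_normD _ _))// ltrD ?SE// distrC SE.
exists x => e e0; have e2 : 0 < e / 2 by rewrite divr_gt0.
have [k1 k1P] := xP _ e2; have [k2 k2P] := half_lt _ e2.
pose k := maxn k1 k2; exists (n k) => i ni.
rewrite -(subrK (v k) (u i)) -addrA [ltRHS]splitr.
apply: le_lt_trans (hm_norm_atD _ _ _) _; rewrite ltrD//.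
  apply: lt_trans (nP k _ _ ni (le_n _ _ (leqnn k))) _.
  by rewrite k2P ?leq_maxr.
rewrite -(subrK (S k) (v k)) -addrA (le_lt_trans (hm_norm_atD _ _ _))//.
rewrite hm_norm_atB Sv add0r (le_lt_trans (hm_norm_at_le _ _))//.
by rewrite k1P ?leq_maxl.
Qed.

Definition pointwise_form m : complete_semi_form D :=
  CompleteSemiForm (hm_ip_semi_inner D m) (@hm_norm_at_complete m).

End PointwiseNorm.

(** * Gluing the fibres of a module into a continuous field *)

Section Bump.
Variables (R : realType) (M : topologicalType).
Hypothesis lcM : locally_compact [set: M].
Hypothesis hM : hausdorff_space M.

Lemma C0_bump (m : M) (W : set M) : nbhs m W ->
  exists f : C0 R M, [/\ forall n, 0 <= f n, \forall n \near m, 1 <= f n &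
    forall n, ~ W n -> f n = 0].
Proof.
move=> Wm; have [U] := @lcM m I; rewrite withinET => Um [cU clU].
pose B := ~` (W `&` U)°.
have clB : closed B by apply: open_closedC; exact: open_interior.
have nBm : ~ B m by move=> /(_ _); apply; exact: filterI.
have /(@uniform_separatorP _ R)[f [fc f01 f0 f1]] :=
  @locally_compact_completely_regular M R lcM hM _ _ clB nBm.
have fR n : 0 <= f n <= 1.
  by have := f01 (f n) (ex_intro2 _ _ n I erefl); rewrite /= in_itv.
have fm : f m = 0 by apply: f0; exists m.
have fB n : ~ (W `&` U) n -> f n = 1.
  by move=> nWU; apply: f1; exists n => // /interior_subset.
(* The separating function f is 0 at m and 1 off the compact neighbourhood. The factor 2 makes g at
   least 1 on a whole neighbourhood of m, namely wherever f <= 1/2. *)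
pose g n : R[i] := (2 * (1 - f n))%:C.
have gC : is_C0 g.
  split=> [n|e e0].
    apply/continuousC_P => e /gt0_real_complex[r r0 ->].
    have /cvgrPdist_lt/(_ _ (divr_gt0 r0 (ltr0Sn R 1))) := fc n.
    apply: filterS => k fnk; rewrite -rmorphB normc_def /= expr0n addr0 sqrtr_sqr ltcR.
    have -> : 2 * (1 - f n) - 2 * (1 - f k) = - (2 * (f n - f k)) by ring.
    by rewrite normrN normrM ger0_norm// mulrC -ltr_pdivlMr.
  by exists U => // n nU; rewrite /g fB ?subrr ?mulr0 ?normr0// => -[].
exists (C0_of gC); split=> [n||n nW] /=.
- by rewrite lecR mulr_ge0// subr_ge0; have /andP[] := fR n.
- have half0 : 0 < 2^-1 :> R by rewrite invr_gt0.
  have /cvgrPdist_lt/(_ _ half0) := fc m; apply: filterS => n.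
  rewrite fm sub0r normrN => fn; rewrite lecR; have := ler_norm (f n); lra.
- by rewrite /g fB ?subrr ?mulr0// => -[].
Qed.

End Bump.

Section FieldOfModule.
Variables (R : realType) (M : topologicalType) (D : hilbertModule R M).
Hypothesis lcM : locally_compact [set: M].
Hypothesis hM : hausdorff_space M.
Implicit Types (x y : D) (m : M).

Definition fibre m : hilbertSpace R :=
  projT1 (cid (hilbert_quotient (pointwise_form D m))).

Definition fibre_pi m : D -> fibre m :=
  projT1 (cid (projT2 (cid (hilbert_quotient (pointwise_form D m))))).

Lemma fibre_piP m : [/\ linear (@fibre_pi m),
  (forall h, exists x, fibre_pi m x = h) &
  forall x y, inner (fibre_pi m x) (fibre_pi m y) = hm_ip x y m].
Proof. exact: projT2 (cid (projT2 (cid (hilbert_quotient (pointwise_form D m))))). Qed.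

Lemma fibre_pi_linear m : linear (@fibre_pi m).
Proof. by have [] := fibre_piP m. Qed.

Lemma fibre_pi_inner m x y : inner (fibre_pi m x) (fibre_pi m y) = hm_ip x y m.
Proof. by have [] := fibre_piP m. Qed.

Lemma fibre_pi_surj m (h : fibre m) : exists x, fibre_pi m x = h.
Proof. by have [] := fibre_piP m. Qed.

Lemma fibre_pi_norm m x : `|fibre_pi m x| = hm_norm_at x m.
Proof. by rewrite norm_seminorm /seminorm fibre_pi_inner. Qed.

Lemma fibre_piB m x y : fibre_pi m (x - y) = fibre_pi m x - fibre_pi m y.
Proof. by rewrite [x - y]addrC -scaleN1r fibre_pi_linear scaleN1r addrC. Qed.

Lemma fibre_pi_eq m x y : hm_norm_at (x - y) m = 0 -> fibre_pi m x = fibre_pi m y.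
Proof.
move=> xy; apply/eqP; rewrite -subr_eq0 -fibre_piB -normr_eq0.
by rewrite fibre_pi_norm xy.
Qed.

Lemma fibre_pi0 m : fibre_pi m 0 = 0.
Proof. by rewrite -[X in fibre_pi _ X](subrr 0) fibre_piB subrr. Qed.

Lemma fibre_piD m x y : fibre_pi m (x + y) = fibre_pi m x + fibre_pi m y.
Proof. by have := fibre_pi_linear m 1 x y; rewrite !scale1r. Qed.

Lemma fibre_piZ m a x : fibre_pi m (a *: x) = a *: fibre_pi m x.
Proof. by have := fibre_pi_linear m a x 0; rewrite fibre_pi0 !addr0. Qed.

Lemma fibre_pi_act m f x : fibre_pi m (hm_act f x) = f m *: fibre_pi m x.
Proof. by rewrite -fibre_piZ; apply: fibre_pi_eq; exact: hm_norm_at_act_sub. Qed.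

Definition module_sections : set (forall m, fibre m) :=
  [set xi | exists x, xi = fibre_pi^~ x].

Lemma module_sections_approx (xi : forall m, fibre m) (e : R[i]) :
  is_C0 (fun m => `|xi m| : R[i]) ->
  (forall (d : R[i]) m, 0 < d -> exists2 eta, module_sections eta &
     \forall n \near m, `|xi n - eta n| < d) ->
  0 < e -> exists x, forall m, `|xi m - fibre_pi m x| < e.
Proof.
(* One third of e is spent on the averaged local errors, one on the defect of the weights, and the
   last one makes the bound strict. *)
move=> xiC xiL e0; have [d d0 dE] : exists2 d, 0 < d & e = d + d + d.
  by exists (e / 3); [rewrite divr_gt0|field].
have [B BP] := is_C0_bounded xiC.
have B0 : 0 < 1 + `|B%:C| by rewrite ltr_pwDl.
have {}BP m : `|xi m| <= 1 + `|B%:C|.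
  have := BP m; rewrite normr_id => /le_trans; apply.
  have B1 : 0 <= B%:C by apply: le_trans (BP m).
  by rewrite ger0_norm// lerDr.
set b := 1 + _ in B0 BP.
have [_ /(_ _ d0)[K cK KP]] := xiC.
(* A bump is paired with an element of D that is d-close to [xi] wherever the bump does not
   vanish. *)
pose good (s : seq (C0 R M * D)) := forall n fx, fx \in s ->
  0 <= fx.1 n /\ (fx.1 n != 0 -> `|xi n - fibre_pi n fx.2| < d).
pose total (s : seq (C0 R M * D)) n := \sum_(fx <- s) fx.1 n.
have total_ge0 s n : good s -> 0 <= total s n.
  by move=> gs; rewrite /total big_seq sumr_ge0// => fx /(gs n)[].
(* Lists are compared by the sums of their bumps, and concatenation dominates both lists. Near
   covering of K then yields one finite list whose sum is at least 1 on K. *)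
pose F := filter_from good (fun s0 => [set s | good s /\
  forall n, total s0 n <= total s n]).
have FF : Filter F.
  apply: filter_from_filter; first by exists [::].
  move=> s1 s2 g1 g2; exists (s1 ++ s2).
    by move=> n fx; rewrite mem_cat => /orP[/(g1 n)|/(g2 n)].
  have tot n : total (s1 ++ s2) n = total s1 n + total s2 n by rewrite /total big_cat.
  move=> s [gs ts]; split; split=> // n; apply: le_trans (ts n); rewrite tot.
    by rewrite lerDl total_ge0.
  by rewrite lerDr total_ge0.
have /compact_near_coveringP cover := cK.
have [n _|s0 g0 s0P] := cover _ F (fun s n => good s /\ 1 <= total s n) FF.
  have [eta [x etaE] etaP] := xiL _ n d0.
  have [f [f0 f1 fW]] := C0_bump R lcM hM etaP.
  have gf : good [:: (f, x)].
    move=> k fx; rewrite inE => /eqP -> /=; split => // fk.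
    have [] := pselect (`|xi k - eta k| < d); first by rewrite etaE.
    by move=> /fW fk0; rewrite fk0 eqxx in fk.
  exists ([set k | 1 <= f k],
    [set s | good s /\ forall k, total [:: (f, x)] k <= total s k]).
    by split => //; exists [:: (f, x)].
  move=> [k s] [/= fk [gs ts]]; split => //; apply: le_trans (ts k).
  by rewrite /total big_seq1.
have {}s0P n : K n -> 1 <= total s0 n.
  by move=> Kn; have [] := s0P s0 (conj g0 (fun n => lexx _)) n Kn.
(* The weights [f / (F + del)], for [F] the sum of the bumps [f], add up to
   [1 - del / (F + del)], and [F >= 1] on [K]. *)
have [del del0 delE] : exists2 del, 0 < del & d = del * b.
  by exists (d / b); [rewrite divr_gt0|rewrite divfK ?gt_eqF].
have den n : 0 < total s0 n + del by rewrite ltr_wpDl ?total_ge0.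
have [totc _] : is_C0 (total s0).
  by apply: is_C0_sum => fx; exact: C0P.
have phiC (fx : C0 R M * D) : is_C0 (fun n => fx.1 n * (total s0 n + del)^-1).
  apply: (@is_C0_mul_bounded _ _ _ _ del^-1); first exact: C0P.
    move=> n; apply: cvgV; first by rewrite gt_eqF.
    by apply: cvgD; [exact: totc|exact: cvg_cst].
  move=> n; rewrite ger0_norm ?invr_ge0 ?(ltW (den n))//.
  by rewrite lef_pV2 ?posrE// lerDr total_ge0.
have [phi phiE] : exists phi : C0 R M * D -> C0 R M,
    forall fx n, phi fx n = fx.1 n / (total s0 n + del).
  by exists (fun fx => C0_of (phiC fx)).
exists (\sum_(fx <- s0) hm_act (phi fx) fx.2) => m.
have piE : fibre_pi m (\sum_(fx <- s0) hm_act (phi fx) fx.2) =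
    \sum_(fx <- s0) (fx.1 m / (total s0 m + del)) *: fibre_pi m fx.2.
  have piE s : fibre_pi m (\sum_(fx <- s) hm_act (phi fx) fx.2) =
      \sum_(fx <- s) phi fx m *: fibre_pi m fx.2.
    elim: s => [|fx s IH]; first by rewrite !big_nil fibre_pi0.
    by rewrite !big_cons fibre_piD IH fibre_pi_act.
  by rewrite piE; apply: eq_bigr => fx _; rewrite phiE.
rewrite piE; set T := total s0 m; have T0 : 0 <= T by exact: total_ge0.
have dT : 0 < T + del := den m.
(* The error is a weighted sum of the local errors plus the missing weight [del / (T + del)] times
   [xi]. *)
have -> : xi m - \sum_(fx <- s0) (fx.1 m / (T + del)) *: fibre_pi m fx.2 =
    \sum_(fx <- s0) (fx.1 m / (T + del)) *: (xi m - fibre_pi m fx.2) +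
    (del / (T + del)) *: xi m.
  have -> : \sum_(fx <- s0) (fx.1 m / (T + del)) *: (xi m - fibre_pi m fx.2) =
      (T / (T + del)) *: xi m - \sum_(fx <- s0) (fx.1 m / (T + del)) *: fibre_pi m fx.2.
    rewrite /T /total mulr_suml scaler_suml -sumrB.
    by apply: eq_bigr => fx _; rewrite scalerBr.
  by rewrite addrAC -scalerDl -mulrDl divff ?gt_eqF// scale1r.
have le1 : `|\sum_(fx <- s0) (fx.1 m / (T + del)) *: (xi m - fibre_pi m fx.2)| <= d.
  apply: (@le_trans _ _ (T / (T + del) * d)); last first.
    by rewrite ler_piMl ?(ltW d0)// ler_pdivrMr// mul1r lerDl ltW.
  rewrite (le_trans (ler_norm_sum _ _ _))// /T /total !mulr_suml -/(total s0 m) -/T.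
  rewrite big_seq [leRHS]big_seq; apply: ler_sum => fx /(g0 m)[f0 fx0].
  rewrite normrZ ger0_norm ?divr_ge0 ?(ltW dT)//.
  have [->|/fx0 fd] := eqVneq (fx.1 m) 0; first by rewrite !mul0r.
  by rewrite ler_wpM2l ?divr_ge0 ?(ltW dT)// ltW.
(* On K one has T >= 1, so the factor is at most [del], and [del * b = d]. Off K the factor is at
   most 1 and [xi] itself is smaller than d. *)
have le2 : `|(del / (T + del)) *: xi m| <= d.
  rewrite normrZ ger0_norm ?divr_ge0 ?(ltW dT) ?(ltW del0)//.
  have [/s0P T1|/KP] := pselect (K m).
    rewrite delE.
    apply: ler_pM; [by rewrite divr_ge0 ?ltW|by []| |exact: BP].
    by rewrite ler_pdivrMr// ler_peMr ?(ltW del0)// (le_trans T1)// lerDl ltW.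
  rewrite normr_id => /ltW; apply: le_trans; rewrite ler_piMl//.
  by rewrite ler_pdivrMr// mul1r lerDr.
apply: le_lt_trans (ler_normD _ _) _; apply: le_lt_trans (lerD le1 le2) _.
by rewrite dE ltrDl.
Qed.

(** The module norm is controlled by the pointwise norms, so uniform approximants with errors
    1/(k+1) form a Cauchy sequence in D; the class of its limit is [xi] at every point. *)
Lemma module_sections_complete (xi : forall m, fibre m) :
  (forall e : R[i], 0 < e -> exists x, forall m, `|xi m - fibre_pi m x| < e) ->
  module_sections xi.
Proof.
move=> xiA; have inv0 k : 0 < k.+1%:R^-1 :> R[i] by rewrite invr_gt0.
have /choice[u uP] := fun k => xiA _ (inv0 k).
have close x y (d1 d2 : R[i]) : 0 < d1 -> 0 < d2 ->
    (forall m, `|xi m - fibre_pi m x| < d1) ->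
    (forall m, `|xi m - fibre_pi m y| < d2) -> `|x - y| <= d1 + d2.
  move=> d10 d20 xd yd; apply: hm_norm_le => [|m]; first by rewrite addr_ge0 ?ltW.
  rewrite -fibre_pi_norm fibre_piB -(subrK (xi m) (fibre_pi m x)) -addrA.
  by rewrite (le_trans (ler_normD _ _))// lerD ?ltW// distrC.
have [e e0|x xP] := @cauchy_seq_limit R D u.
  have e2 : 0 < e / 2 by rewrite divr_gt0.
  have [n nP] := exists_inv_lt e2; exists n => i j ni nj.
  have le := close _ _ _ _ (inv0 i) (inv0 j) (uP i) (uP j).
  by rewrite (le_lt_trans le)// [ltRHS]splitr ltrD ?nP.
exists x; apply: functional_extensionality_dep => m.
apply/eqP; rewrite -subr_eq0 -normr_eq0.
apply/negPn/negP => c0; set c := `|_| in c0.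
have c2 : 0 < c / 2 by rewrite divr_gt0// lt_neqAle eq_sym c0 normr_ge0.
have [n1 n1P] := exists_inv_lt c2; have [n2 n2P] := xP _ c2.
pose k := maxn n1 n2.
suff : c < c by rewrite ltxx.
rewrite [ltRHS]splitr {1}/c -(subrK (fibre_pi m (u k)) (xi m)) -addrA.
rewrite (le_lt_trans (ler_normD _ _))// ltrD//.
  by rewrite (lt_trans (uP k m))// n1P ?leq_maxl.
rewrite -fibre_piB fibre_pi_norm (le_lt_trans (hm_norm_at_le _ _))//.
by rewrite n2P ?leq_maxr.
Qed.

Lemma module_sections_norm_C0 xi : module_sections xi ->
  is_C0 (fun m => `|xi m| : R[i]).
Proof.
move=> [x ->]; rewrite (_ : (fun m => _) = hm_norm_at x); first exact: hm_norm_at_C0.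
by apply/funext => m; rewrite fibre_pi_norm.
Qed.

Definition field_of_module : continuousField R M.
Proof.
refine (@ContinuousField R M fibre module_sections _ _ _ module_sections_norm_C0 _).
- by exists 0; apply: functional_extensionality_dep => m; rewrite fibre_pi0.
- move=> c _ _ [x ->] [y ->]; exists (c *: x + y).
  by apply: functional_extensionality_dep => m; rewrite fibre_pi_linear.
- by move=> m h; have [x xh] := fibre_pi_surj h; exists (fibre_pi^~ x) => //; exists x.
- move=> xi xiC xiL; apply: module_sections_complete => e e0.
  exact: module_sections_approx.
Defined.

End FieldOfModule.

(** * The representation of G defined by a representation of Bis(G) *)

Section RepresentationOfBisections.
Variables (R : realType) (M : topologicalType) (G : topGroupoid M).
Hypothesis lcM : locally_compact [set: M].
Hypothesis hM : hausdorff_space M.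
Hypothesis G_bis : bisectional G.
Variable t : bisectionRep R G.
Implicit Types (s : bisection G) (x y : t) (g : G).

Let H := @field_of_module R M t lcM hM.
Let pi m : t -> H m := @fibre_pi R M t m.

Let pi_eq m x y : hm_norm_at (x - y) m = 0 -> pi m x = pi m y.
Proof. exact: fibre_pi_eq. Qed.

Let piB m x y : pi m (x - y) = pi m x - pi m y.
Proof. exact: fibre_piB. Qed.

Let pi_linear m : linear (@pi m).
Proof. exact: fibre_pi_linear. Qed.

Let pi_norm m x : `|pi m x| = hm_norm_at x m.
Proof. exact: fibre_pi_norm. Qed.

Let pi_inner m x y : inner (pi m x) (pi m y) = hm_ip x y m.
Proof. exact: fibre_pi_inner. Qed.

Let pi_surj m (h : H m) : exists x, pi m x = h.
Proof. exact: fibre_pi_surj. Qed.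

Lemma br_opB s x y : br_op s (x - y) = br_op s x - br_op s y.
Proof. by rewrite [x - y]addrC -scaleN1r br_linear scaleN1r addrC. Qed.

Lemma br_op_norm_at s x m : hm_norm_at (br_op s x) m = hm_norm_at x (src (s m)).
Proof. by rewrite /hm_norm_at br_unitary. Qed.

Lemma bisVK s m : (s^-1)%g (src (s m)) = inv (s m).
Proof. by have [K _ _ _] := bis_base_invP s; rewrite /= K. Qed.

(** If [s m = s' m], then [s^-1 * s'] is a unit at [src (s m)]. Locality applies there, and
    unitarity of [br_op s] carries the conclusion from [src (s m)] to m. *)
Lemma br_op_local s s' m x : s m = s' m -> hm_norm_at (br_op s x - br_op s' x) m = 0.
Proof.
move=> ss'.
have -> : br_op s' x = br_op s (br_op (s^-1 * s')%g x).
  by rewrite -br_mul mulgA mulgV mul1g.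
rewrite -br_opB br_op_norm_at hm_norm_atB; apply: br_local.
have E : (s^-1 * s')%g (src (s m)) = (s^-1 * s)%g (src (s m)).
  by rewrite /= /bis_base bisVK src_inv tgt_bis ss'.
by rewrite E mulVg.
Qed.

Lemma fibre_pi_br_op s s' m x x' : s m = s' m ->
  pi (src (s m)) x = pi (src (s m)) x' -> pi m (br_op s x) = pi m (br_op s' x').
Proof.
move=> ss' xx'; transitivity (pi m (br_op s x')); apply: pi_eq; last exact: br_op_local.
rewrite -br_opB br_op_norm_at -pi_norm piB.
by rewrite xx' subrr normr0.
Qed.

Lemma exists_bisection g : exists s, s (tgt g) = g.
Proof. by have [bt _] := G_bis; have [s [m <-]] := bt g; exists s; rewrite tgt_bis. Qed.

(** The bisection through g and the representative of h are arbitrary choices; [op_of_pi] shows that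
    they do not matter and is how the operator is computed afterwards. *)
Definition op_of g (h : H (src g)) : H (tgt g) :=
  pi (tgt g) (br_op (sval (cid (exists_bisection g))) (sval (cid (pi_surj h)))).

Lemma op_of_pi s g x : s (tgt g) = g ->
  op_of (pi (src g) x) = pi (tgt g) (br_op s x).
Proof.
move=> sg; have s'g := svalP (cid (exists_bisection g)).
apply: fibre_pi_br_op; first by rewrite sg.
by rewrite s'g; exact: svalP (cid (pi_surj (pi (src g) x))).
Qed.

Lemma along_op_of s g m n x (e : src g = m) (e' : tgt g = n) : s n = g ->
  along op_of e e' (pi m x) = pi n (br_op s x).
Proof. by case: _ / e; case: _ / e'; exact: op_of_pi. Qed.

Lemma op_of_unitary g : unitary_op (@op_of g).
Proof.
have [s sg] := exists_bisection g; split=> [a h k|h k|h].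
- have [x <-] := pi_surj h; have [y <-] := pi_surj k.
  rewrite -pi_linear !(op_of_pi _ sg) br_linear.
  exact: pi_linear.
- have [x <-] := pi_surj h; have [y <-] := pi_surj k.
  by rewrite !(op_of_pi _ sg) !pi_inner br_unitary /= sg.
- have [x <-] := pi_surj h; exists (pi (src g) (br_op (s^-1)%g x)).
  by rewrite (op_of_pi _ sg) -br_mul mulgV br_one.
Qed.

Lemma op_of_unt m (h : H m) : along op_of (src_unt G m) (tgt_unt G m) h = h.
Proof.
have [x <-] := pi_surj h.
by rewrite (@along_op_of 1%g)// br_one.
Qed.

Lemma op_of_mul g g' (c : src g = tgt g') (h : H (src g')) :
  along op_of (src_mul c) (tgt_mul c) h = along op_of c erefl (op_of h).
Proof.
have [s sg] := exists_bisection g; have [s' sg'] := exists_bisection g'.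
have [x <-] := pi_surj h.
have ss' : (s * s')%g (tgt g) = mul g g' by rewrite /= /bis_base sg c sg'.
by rewrite (op_of_pi _ sg') (along_op_of _ _ _ ss') (along_op_of _ _ _ sg) br_mul.
Qed.

Lemma op_of_inv g :
  cancel (@op_of g) (along op_of (src_inv g) (tgt_inv g)) /\
  cancel (along op_of (src_inv g) (tgt_inv g)) (@op_of g).
Proof.
have [s sg] := exists_bisection g.
have s'g : (s^-1)%g (src g) = inv g by rewrite -{1}sg bisVK sg.
split=> h; have [x <-] := pi_surj h.
  by rewrite (op_of_pi _ sg) (along_op_of _ _ _ s'g) -br_mul mulVg br_one.
by rewrite (along_op_of _ _ _ s'g) (op_of_pi _ sg) -br_mul mulgV br_one.
Qed.

Lemma op_of_continuous :
  continuous (fun z : fibred_product G H => Total (op_of (fp_vec z)) : total_space H).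
Proof.
move=> z0; apply: total_space_cvg.
  exact: (@fmap_filter _ _ _ _ (@nbhs_filter (fibred_product G H) z0)).
move=> e _ V e0 [y ->] oV [/= Vz].
set g0 := fp_arrow z0 in Vz *; set h0 : H (src g0) := fp_vec z0.
have [s0 sg0] := exists_bisection g0; have [x xh0] := pi_surj h0.
have oph0 : op_of h0 = pi (tgt g0) (br_op s0 x) by rewrite -xh0 (op_of_pi _ sg0).
rewrite oph0 -piB pi_norm => c_lt.
set c := hm_norm_at _ _ in c_lt.
(* Write c for the distance at the base arrow. The three summands pay for moving h, moving the
   bisection, and moving the target point, where the distance may grow from c to c + d. *)
have [d d0 dE] : exists2 d, 0 < d & e = d + d + (c + d).
  exists ((e - c) / 3); last by field.
  by rewrite divr_gt0// subr_gt0.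
pose W := [set s | `|br_op s0 x - br_op s x| < d].
have [K [V' [cK oV' s0K KW]]] : exists K V',
    [/\ compact K, open V', bis_nbhs K V' s0 & bis_nbhs K V' `<=` W].
  apply: bis_nbhsE => //.
  have : continuous (fun s => br_op s x).
    move=> s.
    apply: (@continuous_comp _ _ _ (fun s => (s, x)) (fun z => br_op z.1 z.2)).
      apply: (@cvg_pair _ _ _ (nbhs s) (nbhs s) (nbhs x) _ _ _ id (cst x)).
        exact: cvg_id.
      exact: cvg_cst.
    exact: br_continuous.
  by move=> /(_ s0)/cvgrPdist_lt/(_ _ d0).
(* Here bisectionality enters: every arrow near [g0] lies on some bisection s so close to [s0] that
   [br_op s x] is within d of [br_op s0 x]. The bisection varies with the arrow, but the estimate is
   uniform. *)
pose O1 := \bigcup_(s in bis_nbhs K V') range s.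
have O1g0 : nbhs g0 O1.
  apply: open_nbhs_nbhs; split; first by have [_] := G_bis; apply.
  by exists s0 => //; exists (tgt g0).
pose O2 := [set n | V n /\ hm_norm_at (br_op s0 x - y) n < c + d].
have O2g0 : nbhs (tgt g0) O2.
  apply: filterI; first exact: open_nbhs_nbhs.
  have /continuousC_P/(_ _ d0) := @hm_norm_at_continuous _ _ _ (br_op s0 x - y) (tgt g0).
  apply: filterS => n; rewrite distrC -/c => cn.
  rewrite -ltrBlDl; apply: le_lt_trans cn; apply: real_ler_norm.
  by rewrite realB ?ger0_real ?hm_norm_at_ge0.
have O3h0 : nbhs (Total h0 : total_space H) (tube d (pi^~ x) setT).
  apply: open_nbhs_nbhs; split.
    by apply: tube_open => //; [exists x|exact: openT].
  by split => //=; rewrite -xh0 subrr normr0.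
have nz : nbhs z0 (@fp_incl _ _ G H @^-1`
    ((O1 `&` tgt (t := G) @^-1` O2) `*` tube d (pi^~ x) setT)).
  apply: (@initial_continuous _ _ (@fp_incl _ _ G H) z0).
  exists (O1 `&` tgt (t := G) @^-1` O2, tube d (pi^~ x) setT) => //=; split => //.
  by apply: filterI => //; exact: tgt_continuous.
apply: filterS nz => -[g h] [/= [[s sK [n _ sn]] [Vg cg]] [_ hd]].
split => //=; have sg : s (tgt g) = g by rewrite -sn tgt_bis.
have [hx hxE] := pi_surj h.
rewrite -hxE (op_of_pi _ sg) -piB pi_norm dE.
rewrite -hxE -piB pi_norm in hd.
have -> : br_op s hx - y = br_op s (hx - x) + (br_op s x - br_op s0 x) + (br_op s0 x - y).
  by rewrite br_opB !addrA !subrK.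
apply: le_lt_trans (hm_norm_atD _ _ _) _; rewrite ltrD//.
apply: le_lt_trans (hm_norm_atD _ _ _) _; rewrite ltrD//.
  by rewrite br_op_norm_at sg.
rewrite hm_norm_atB; apply: le_lt_trans (hm_norm_at_le _ _) _; exact: KW.
Qed.

Definition unitaryRep_of : unitaryRep R G :=
  @UnitaryRep R M G H op_of op_of_unitary op_of_unt op_of_mul op_of_inv
    op_of_continuous.

Lemma unitaryRep_ofP : induced_by unitaryRep_of t.
Proof.
exists (fun x m => pi m x).
  split.
  - by move=> c x y m; exact: pi_linear.
  - by move=> f x m; exact: fibre_pi_act.
  - by move=> x y m; rewrite pi_inner.
  - apply/seteqP; split=> [_ [x _ <-]|_ [x ->]]; first by exists x.
    by exists x.
by move=> s x m; rewrite (@along_op_of s).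
Qed.

End RepresentationOfBisections.

Theorem theorem2p26 (R : realType) (M : topologicalType) (G : topGroupoid M)
    (M_locally_compact : locally_compact [set: M])
    (M_hausdorff : hausdorff_space M)
    (Bis_topological_group : bis_topological_group G)
    (G_bisectional : bisectional G) :
  exists F : unitaryRep R G -> bisectionRep R G,
  [/\ forall p : unitaryRep R G, induced_by p (F p),
      forall p p' : unitaryRep R G,
        unitaryRep_iso p p' <-> bisectionRep_iso (F p) (F p') &
      forall t : bisectionRep R G,
        exists p : unitaryRep R G, bisectionRep_iso (F p) t].
Proof.
have [_ invc] := Bis_topological_group; have [bis_total _] := G_bisectional.
pose F (p : unitaryRep R G) := induced_rep M_locally_compact invc p.
have FP p : induced_by p (F p) := induced_repP _ _ p.
exists F; split => // [p p'|t].
  split; first exact: (unitaryRep_iso_bisectionRep (FP p) (FP p')).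
  exact: (bisectionRep_iso_unitaryRep bis_total (FP p) (FP p')).
exists (unitaryRep_of M_locally_compact M_hausdorff G_bisectional t).
(* Both [t] and the image under [F] are induced by the same groupoid representation, so the identity
   on it yields the isomorphism. *)
apply: (unitaryRep_iso_bisectionRep (FP _) (unitaryRep_ofP _ _ _ _)).
exists (fun=> id); split => // m; split => // z; by exists z.
Qed.
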